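(* Let $\mu,\varepsilon\in\{+,-\}$, and let $X_1=A_{k_1}^{u_1}$, $X_2=A_{k_2}^{u_2}$ be simple objects of $\mathcal{E}(\mathrm{SL}(2,q))$ with $k_1,k_2\in[1,2h-1]$, $u_1,u_2\in\mathbb{Z}_{q-1}$. Put $t_j=e^{k_j}+e^{-k_j}$ and suppose $t_1=\mu t_2$ (equivalently, $k_2=k_1$ if $\mu=+$ and $k_2=2h-k_1$ if $\mu=-$). Then, for $X=X_1\odot X_2$, $$X_{[\mu\mathbf b_\varepsilon]}\cong\bigoplus_{v\in\mathbb{F}_q}\left(B_{\mu,\varepsilon}^{\nu,v}\oplus B_{\mu,\varepsilon}^{\nu,v}\right).$$
   Context: General setting. For a finite group $\Gamma$, $\mathcal{E}(\Gamma)$ is the category of finite-dimensional representations of the quantum double $D(\Gamma)$. Its objects are $\Gamma$-graded finite-dimensional complex vector spaces $U=\bigoplus_{x\in\Gamma}U_x$ with a left linear action $g\mapsto L^U_g$ of $\Gamma$ with $L^U_g(U_x)=U_{gxg^{-1}}$; morphisms are grading-preserving equivariant linear maps. Tensor product: $(U\odot V)_x=\bigoplus_{x_1x_2=x}U_{x_1}\otimes V_{x_2}$ with diagonal action. For $x\in\Gamma$ and an irreducible representation $\rho$ of the centralizer $\mathrm{Cen}(x)$ on $U(\rho)$, $U(x,\rho)$ is the simple object with $U(x,\rho)_y=U(\rho)$ for $y\in[x]$ (the conjugacy class of $x$), $0$ otherwise, with the induced action: fix left coset representatives $R_x$ of $\mathrm{Cen}(x)$; for $g\in\Gamma$, $a\in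 R_x$ write $ga=a'b$ with $a'\in R_x$, $b\in\mathrm{Cen}(x)$, and let $L_g:U(x,\rho)_{axa^{-1}}\to U(x,\rho)_{a'xa'^{-1}}$ be $\rho(b)$. For an object $X$, $X_{[x]}=\bigoplus_{y\in[x]}X_y$ is the subobject supported on $[x]$. Notation for $\mathrm{SL}(2,q)$. $q=p^n\ge5$, $p$ an odd prime, $q=4h+1$; $\Gamma=\mathrm{SL}(2,q)$. For integers $a<b$, $[a,b]=\{a,a+1,\dots,b\}$. $\acute{+}=0$, $\acute{-}=1$; signs $\pm$ are identified with $\pm1$. $\check e$ is a fixed generator of $\mathbb{F}_{q^2}^\times$ and $e=\check e^{4h+2}$ (a generator of $\mathbb{F}_q^\times$); $\zeta_m=\exp(2\pi i/m)$; $\mathrm{tr}:\mathbb{F}_q\to\mathbb{F}_p$ is the trace. Let $\mathbf e$ be the identity matrix, $\mathbf{a}=\mathrm{diag}(e,e^{-1})$, $\mathbf{b}(y)=\begin{pmatrix}1&y\\0&1\end{pmatrix}$, $\mathbf{b}_\varepsilon=\mathbf{b}(e^{\acute\varepsilon})$ for $\varepsilon\in\{+,-\}$. One has $\mathrm{Cen}(\mathbf a^k)=\langle\mathbf a\rangle\cong\mathbb{Z}_{q-1}$ ($k\in[1,2h-1]$) and $\mathrm{Cen}(\mu\mathbf b_\varepsilon)=\{\pm\mathbf b(c):c\in\mathbb{F}_q\}$. Simple objects: $A_k^u=U(\mathbf a^k,u^* )$ for $k\in[1,2h-1]$, $u\in\mathbb{Z}_{q-1}$, $u^*(\mathbf a^{i})=\zeta_{q-1}^{iu}$;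 $B^{\nu,v}_{\mu,\varepsilon}=U(\mu\mathbf b_\varepsilon,(\nu,v)^* )$ for $\mu,\varepsilon,\nu\in\{+,-\}$, $v\in\mathbb{F}_q$, $(\nu,v)^*(\eta\mathbf b(c))=\eta^{\acute\nu}\zeta_p^{\mathrm{tr}(vc)}$ ($\eta=\pm1$). The parity of $U(x,\rho)$ is even if $\rho(-\mathbf e)=1$ and odd if $\rho(-\mathbf e)=-1$. Let $\nu=+$ if $X_1,X_2$ have the same parity and $\nu=-$ otherwise. *)

(* Defs.v *)
From HB Require Import structures.
From mathcomp Require Import all_boot all_order all_algebra all_fingroup.
From mathcomp Require Import all_solvable all_field mxrepresentation.
From mathcomp Require Import complex reals trigo zify.

Set Implicit Arguments.
Unset Strict Implicit.
Unset Printing Implicit Defensive.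

Import Order.TTheory GRing.Theory Num.Theory VectorInternalTheory.
Local Open Scope ring_scope.

Section Objects.
Variables (C : fieldType) (gT : finGroupType).

(* The Gamma-grading is internal: dgr x is the homogeneous component U_x, a
   subspace of the total space, and dact g is the left action L_g. *)
Record dobj := DObj {
  dspace :> vectType C;
  dgr : gT -> {vspace dspace};
  dact : gT -> 'End(dspace);
  dgr_direct : directv (\sum_x dgr x);
  dgr_full : (\sum_x dgr x)%VS = fullv;
  dact1 : dact 1%g = \1%VF;
  dactM : forall g h, dact (g * h)%g = (dact g \o dact h)%VF;
  dactJ : forall g x, (dact g @: dgr x)%VS = dgr (g * x * g^-1)%g }.

Definition dmorphism (U V : dobj) (f : 'Hom(U, V)) : Prop :=
  (forall x, (f @: dgr U x <= dgr V x)%VS) /\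
  (forall g, (f \o dact U g)%VF = (dact V g \o f)%VF).

Definition disom (U V : dobj) : Prop :=
  exists (f : 'Hom(U, V)) (f' : 'Hom(V, U)),
    [/\ dmorphism f, dmorphism f', (f' \o f)%VF = \1%VF & (f \o f')%VF = \1%VF].

Lemma dactJ_sub (U : vectType C) (gr : gT -> {vspace U}) (L : gT -> 'End(U)) :
  L 1%g = \1%VF -> (forall g h, L (g * h)%g = (L g \o L h)%VF) ->
  (forall g x u, u \in gr x -> L g u \in gr (g * x * g^-1)%g) ->
  forall g x, (L g @: gr x)%VS = gr (g * x * g^-1)%g.
Proof.
move=> L1 LM LJ g x; apply/eqP; rewrite eqEsubv; apply/andP; split.
  by apply/subvP => _ /memv_imgP [u ux ->]; exact: LJ.
apply/subvP => v vx.
have -> : v = L g (L g^-1%g v).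
  by rewrite -comp_lfunE -LM mulgV L1 id_lfunE.
apply: memv_img; have := LJ g^-1%g _ _ vx.
by rewrite !mulgA mulVg mul1g invgK -mulgA mulVg mulg1.
Qed.

Definition grade_indep (U : vectType C) (gr : gT -> {vspace U}) : Prop :=
  forall us : gT -> U, (forall x, us x \in gr x) -> \sum_x us x = 0 ->
  forall x, us x = 0.

Lemma grade_indep_direct (U : vectType C) (gr : gT -> {vspace U}) :
  grade_indep gr -> directv (\sum_x gr x).
Proof.
move=> gr_indep; apply/directv_sum_independent => us Hus s0 i _.
by apply: gr_indep s0 i => x; exact: Hus.
Qed.

Lemma mem_dact (U : dobj) g x u :
  u \in dgr U x -> dact U g u \in dgr U (g * x * g^-1)%g.
Proof. by move=> ux; rewrite -dactJ memv_img. Qed.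

Lemma dgr_indep (U : dobj) : grade_indep (dgr U).
Proof.
move=> us Hus s0 x.
by apply: (directv_sum_independent (dgr_direct U)) => //.
Qed.

Lemma dgr_decomp (U : dobj) (u : U) :
  exists2 us : gT -> U, forall x, us x \in dgr U x & u = \sum_x us x.
Proof.
have: u \in (\sum_x dgr U x)%VS by rewrite dgr_full memvf.
by case/memv_sumP => us Hus ->; exists us => // x; exact: Hus.
Qed.

Section DirectSum.
Variables U V : dobj.

Definition dsum_act_fun (g : gT) (w : U * V) : U * V :=
  (dact U g w.1, dact V g w.2).

Fact dsum_act_linear g : linear (dsum_act_fun g).
Proof. by move=> a w w'; rewrite /dsum_act_fun !linearP. Qed.

HB.instance Definition _ g :=
  GRing.isLinear.Build C (U * V)%type (U * V)%type *:%R (dsum_act_fun g)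
    (dsum_act_linear g).

Definition dsum_act g : 'End((U * V)%type) := linfun (dsum_act_fun g).

Definition dsum_gr x : {vspace (U * V)%type} :=
  (linfun fst @^-1: dgr U x :&: linfun snd @^-1: dgr V x)%VS.

Lemma mem_dsum_gr x w :
  (w \in dsum_gr x) = (w.1 \in dgr U x) && (w.2 \in dgr V x).
Proof. by rewrite memv_cap -!memv_preim !lfunE. Qed.

Fact dsum_gr_indep : grade_indep dsum_gr.
Proof.
move=> us Hus s0 i.
have H j : (us j).1 \in dgr U j /\ (us j).2 \in dgr V j.
  by apply/andP; rewrite -mem_dsum_gr Hus.
apply/eqP; rewrite -pair_eqE; apply/andP; split; apply/eqP.
  by apply: (dgr_indep (us := fst \o us)) => [j|]; [case: (H j) |
    rewrite -(raddf_sum fst) s0].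
by apply: (dgr_indep (us := snd \o us)) => [j|]; [case: (H j) |
  rewrite -(raddf_sum snd) s0].
Qed.

Fact dsum_gr_full : (\sum_x dsum_gr x)%VS = fullv.
Proof.
apply/vspaceP => -[u v]; rewrite memvf.
have [us Hu ->] := dgr_decomp u; have [vs Hv ->] := dgr_decomp v.
have -> : (\sum_x us x, \sum_x vs x) = \sum_x (us x, vs x).
  by apply/eqP; rewrite -pair_eqE /pair_eq /= (raddf_sum fst) (raddf_sum snd) !eqxx.
by apply: memv_sumr => x _; rewrite mem_dsum_gr /= Hu Hv.
Qed.

Fact dsum_act1 : dsum_act 1%g = \1%VF.
Proof.
by apply/lfunP => -[u v]; rewrite lfunE /= /dsum_act_fun !dact1 !id_lfunE.
Qed.

Fact dsum_actM g h : dsum_act (g * h)%g = (dsum_act g \o dsum_act h)%VF.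
Proof.
apply/lfunP => -[u v]; rewrite comp_lfunE !lfunE /= /dsum_act_fun /=.
by rewrite !dactM !comp_lfunE.
Qed.

Fact dsum_actJ g x :
  (dsum_act g @: dsum_gr x)%VS = dsum_gr (g * x * g^-1)%g.
Proof.
apply: dactJ_sub dsum_act1 dsum_actM _ g x => g x w.
by rewrite !mem_dsum_gr lfunE /= => /andP [wu wv]; rewrite !mem_dact.
Qed.

Definition dsum : dobj :=
  DObj (grade_indep_direct dsum_gr_indep) dsum_gr_full dsum_act1 dsum_actM dsum_actJ.

End DirectSum.

Section Zero.

Definition dzero_gr (x : gT) : {vspace 'cV[C]_0} := 0%VS.
Definition dzero_act (g : gT) : 'End('cV[C]_0) := \1%VF.

Fact dzero_gr_indep : grade_indep dzero_gr.
Proof. by move=> us _ _ i; rewrite flatmx0. Qed.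

Fact dzero_gr_full : (\sum_x dzero_gr x)%VS = fullv.
Proof. by apply/vspaceP => v; rewrite [v]flatmx0 !mem0v. Qed.

Fact dzero_actM g h : dzero_act (g * h)%g = (dzero_act g \o dzero_act h)%VF.
Proof. by rewrite /dzero_act comp_lfun1l. Qed.

Fact dzero_actJ g x :
  (dzero_act g @: dzero_gr x)%VS = dzero_gr (g * x * g^-1)%g.
Proof. by rewrite limg0. Qed.

Definition dzero : dobj :=
  DObj (grade_indep_direct dzero_gr_indep) dzero_gr_full erefl dzero_actM dzero_actJ.

End Zero.

Section Support.
Variables (U : dobj) (x : gT).

(* X_[x] = \bigoplus_(y in [x]) X_y with the restricted grading and action. *)
Definition supp_space : {vspace U} :=
  (\sum_(y in (x ^: [set: gT])%g) dgr U y)%VS.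

Definition supp_gr y : {vspace subvs_of supp_space} :=
  (linfun vsval @^-1: dgr U y)%VS.

Definition supp_act g : 'End(subvs_of supp_space) :=
  (linfun (vsproj supp_space) \o dact U g \o linfun vsval)%VF.

Lemma mem_supp_gr y w : (w \in supp_gr y) = (vsval w \in dgr U y).
Proof. by rewrite -memv_preim lfunE. Qed.

Lemma supp_space_act g u : u \in supp_space -> dact U g u \in supp_space.
Proof.
case/memv_sumP => us Hus ->; rewrite linear_sum; apply: memv_suml => y yx /=.
have yx' : (g * y * g^-1)%g \in (x ^: [set: gT])%g.
  have -> : (g * y * g^-1)%g = (y ^ g^-1)%g by rewrite conjgE invgK mulgA.
  by rewrite -(class_eqP yx) memJ_class ?inE.
exact: (subvP (sumv_sup _ yx' (subvv _))) (mem_dact g (Hus y yx)).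
Qed.

Lemma val_supp_act g w : vsval (supp_act g w) = dact U g (vsval w).
Proof. by rewrite !comp_lfunE !lfunE /= vsprojK // supp_space_act // subvsP. Qed.

Fact supp_gr_indep : grade_indep supp_gr.
Proof.
move=> us Hus s0 i; apply: val_inj => /=.
apply: (dgr_indep (us := fun j => vsval (us j))) => [j|].
  by rewrite -mem_supp_gr Hus.
by rewrite -linear_sum s0 linear0.
Qed.

Fact supp_gr_full : (\sum_y supp_gr y)%VS = fullv.
Proof.
apply/vspaceP => w; rewrite memvf.
case/memv_sumP: (subvsP w) => us Hus Dw.
have -> : w = \sum_(y in (x ^: [set: gT])%g) vsproj supp_space (us y).
  by rewrite -[LHS]vsvalK Dw linear_sum.
apply: memv_suml => y yx; apply: (subvP (sumv_sup y _ (subvv _))) => //.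
rewrite mem_supp_gr vsprojK ?Hus //.
exact: (subvP (sumv_sup y yx (subvv _))) (Hus y yx).
Qed.

Fact supp_act1 : supp_act 1%g = \1%VF.
Proof.
by apply/lfunP => w; apply: val_inj; rewrite /= val_supp_act dact1 !id_lfunE.
Qed.

Fact supp_actM g h : supp_act (g * h)%g = (supp_act g \o supp_act h)%VF.
Proof.
apply/lfunP => w; apply: val_inj.
by rewrite /= (comp_lfunE (supp_act g)) !val_supp_act dactM comp_lfunE.
Qed.

Fact supp_actJ g y : (supp_act g @: supp_gr y)%VS = supp_gr (g * y * g^-1)%g.
Proof.
apply: dactJ_sub supp_act1 supp_actM _ g y => g y w.
by rewrite !mem_supp_gr val_supp_act; exact: mem_dact.
Qed.

Definition dsupp : dobj :=
  DObj (grade_indep_direct supp_gr_indep) supp_gr_full supp_act1 supp_actM supp_actJ.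

End Support.


Section Tensor.
Variables U V : dobj.

(* U (x) V is realised on matrices, the pure tensor u (x) v being the outer
   product of the coordinate vectors of u and v; L_g (x) L_g is then
   M |-> A^T M B, where A and B act on row coordinate vectors as L_g does. *)
Definition tens (u : U) (v : V) : 'M[C]_(dim U, dim V) := (v2r u)^T *m v2r v.

Definition tensv (A : {vspace U}) (B : {vspace V}) :
    {vspace 'M[C]_(dim U, dim V)} :=
  <<[seq tens u v | u <- vbasis A, v <- vbasis B]>>%VS.

Definition tens_gr x : {vspace 'M[C]_(dim U, dim V)} :=
  (\sum_(yz : gT * gT | (yz.1 * yz.2)%g == x)
     tensv (dgr U yz.1) (dgr V yz.2))%VS.

Definition tens_act g : 'End('M[C]_(dim U, dim V)) :=
  linfun (mulmxr (f2mx (dact V g)) \o mulmx (f2mx (dact U g))^T).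

Lemma v2r_lfun (W W' : vectType C) (f : 'Hom(W, W')) w :
  v2r (f w) = v2r w *m f2mx f.
Proof. by rewrite unlock /= r2vK. Qed.

Lemma tens_actE g u v : tens_act g (tens u v) = tens (dact U g u) (dact V g v).
Proof. by rewrite lfunE /= /tens !v2r_lfun trmx_mul !mulmxA. Qed.

Lemma tens_suml I r (P : pred I) (us : I -> U) v :
  tens (\sum_(i <- r | P i) us i) v = \sum_(i <- r | P i) tens (us i) v.
Proof. by rewrite /tens !linear_sum mulmx_suml. Qed.

Lemma tens_sumr I r (P : pred I) u (vs : I -> V) :
  tens u (\sum_(i <- r | P i) vs i) = \sum_(i <- r | P i) tens u (vs i).
Proof. by rewrite /tens !linear_sum. Qed.

Lemma tensZZ a b u v : tens (a *: u) (b *: v) = (a * b) *: tens u v.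
Proof.
rewrite /tens [v2r (a *: u)]linearZ [v2r (b *: v)]linearZ /=.
by rewrite [(a *: v2r u)^T]linearZ /= -scalemxAr -scalemxAl scalerA mulrC.
Qed.

Lemma mem_tensv (A : {vspace U}) (B : {vspace V}) u v :
  u \in A -> v \in B -> tens u v \in tensv A B.
Proof.
move=> /coord_vbasis -> /coord_vbasis ->; rewrite tens_suml.
apply: memv_suml => i _; rewrite tens_sumr; apply: memv_suml => j _.
rewrite tensZZ memvZ // memv_span //.
apply/allpairsP; exists ((vbasis A)`_i, (vbasis B)`_j) => /=.
by rewrite !mem_nth ?size_tuple.
Qed.

Lemma tensv_subv (A : {vspace U}) (B : {vspace V}) (W : {vspace 'M[C]_(dim U, dim V)}) :
  (forall u v, u \in A -> v \in B -> tens u v \in W) -> (tensv A B <= W)%VS.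
Proof.
move=> sW; apply/span_subvP => _ /allpairsP [[u v] /= [uA vB ->]].
by rewrite sW // vbasis_mem.
Qed.

Lemma dim_tensv A B : (\dim (tensv A B) <= \dim A * \dim B)%N.
Proof. by rewrite (leq_trans (dim_span _)) // size_allpairs !size_tuple. Qed.

Lemma mem_tens_gr x y u v :
  u \in dgr U x -> v \in dgr V y -> tens u v \in tens_gr (x * y)%g.
Proof.
move=> ux vy; apply: (subvP (sumv_sup (x, y) _ (subvv _))) => //=.
exact: mem_tensv.
Qed.

Lemma sum_dim_dgr (W : dobj) : (\sum_x \dim (dgr W x))%N = dim W.
Proof. by rewrite -dimvf -(dgr_full W); have /directvP /= -> := dgr_direct W. Qed.

Fact tens_gr_full : (\sum_x tens_gr x)%VS = fullv.
Proof.
apply/vspaceP => M; rewrite memvf [M]matrix_sum_delta.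
apply: memv_suml => i _; apply: memv_suml => j _; apply: memvZ.
have -> : delta_mx i j = tens (r2v (delta_mx 0 i)) (r2v (delta_mx 0 j)).
  by rewrite /tens !r2vK trmx_delta mul_delta_mx.
have [us Hu ->] := dgr_decomp (r2v (delta_mx 0 i)).
have [vs Hv ->] := dgr_decomp (r2v (delta_mx 0 j)).
rewrite tens_suml; apply: memv_suml => x _.
rewrite tens_sumr; apply: memv_suml => y _.
exact: (subvP (sumv_sup (x * y)%g _ (subvv _))) (mem_tens_gr (Hu x) (Hv y)).
Qed.

Fact tens_gr_indep : grade_indep tens_gr.
Proof.
have dim_gr x : (\dim (tens_gr x) <= \sum_(yz : gT * gT | (yz.1 * yz.2)%g == x)
    \dim (dgr U yz.1) * \dim (dgr V yz.2))%N.
  apply: (@leq_trans (\sum_(yz : gT * gT | (yz.1 * yz.2)%g == x)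
    \dim (tensv (dgr U yz.1) (dgr V yz.2)))).
    exact: dimv_leq_sum.
  apply: leq_sum => yz _.
  exact: dim_tensv.
have sum_gr : (\sum_x \dim (tens_gr x) <= dim U * dim V)%N.
  apply: (@leq_trans (\sum_x \sum_(yz : gT * gT | (yz.1 * yz.2)%g == x)
    \dim (dgr U yz.1) * \dim (dgr V yz.2))); first exact: leq_sum.
  apply: eq_leq; rewrite (exchange_big_dep xpredT) //=.
  rewrite -!sum_dim_dgr big_distrlr /= pair_bigA /=; apply: eq_bigr => yz _.
  by rewrite (big_pred1 (yz.1 * yz.2)%g) // => x; rewrite /= eq_sym.
move: tens_gr tens_gr_full sum_gr => gr gr_full sum_gr us Hus s0 x.
suffices gr_direct : directv (\sum_x gr x).
  by apply: (directv_sum_independent gr_direct) s0 x _ => // y _; exact: Hus.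
rewrite directvE /= eqn_leq dimv_leq_sum gr_full dimvf.
exact: sum_gr.
Qed.

Lemma f2mx1 (W : vectType C) : f2mx (\1%VF : 'End(W)) = 1%:M.
Proof.
apply/row_matrixP => i; rewrite !rowE -[delta_mx _ _]r2vK -v2r_lfun.
by rewrite id_lfunE mulmx1.
Qed.

Lemma f2mxM (W : vectType C) (f g : 'End(W)) :
  f2mx (f \o g)%VF = f2mx g *m f2mx f.
Proof.
apply/row_matrixP => i; rewrite !rowE mulmxA -[delta_mx _ _]r2vK -!v2r_lfun.
by rewrite comp_lfunE.
Qed.

Fact tens_act1 : tens_act 1%g = \1%VF.
Proof.
apply/lfunP => M.
by rewrite lfunE id_lfunE /= !dact1 !f2mx1 trmx1 mul1mx mulmx1.
Qed.

Fact tens_actM g h : tens_act (g * h)%g = (tens_act g \o tens_act h)%VF.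
Proof.
apply/lfunP => M.
by rewrite comp_lfunE !lfunE /= !dactM !f2mxM trmx_mul !mulmxA.
Qed.

Fact tens_actJ g x :
  (tens_act g @: tens_gr x)%VS = tens_gr (g * x * g^-1)%g.
Proof.
apply: dactJ_sub tens_act1 tens_actM _ g x => g x M Mx.
suffices /subvP sW : (tens_act g @: tens_gr x <= tens_gr (g * x * g^-1)%g)%VS.
  by rewrite sW ?memv_img.
rewrite limg_sum; apply/subv_sumP => -[y z] /= /eqP <-.
rewrite limg_span; apply/span_subvP => _ /mapP [_ /allpairsP [[u v] /= [uA vB ->]] ->].
rewrite tens_actE.
have -> : (g * (y * z) * g^-1 = (g * y * g^-1) * (g * z * g^-1))%g.
  by rewrite !mulgA mulgKV.
by apply: mem_tens_gr; apply: mem_dact; exact: vbasis_mem.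
Qed.

Definition dtens : dobj :=
  DObj (grade_indep_direct tens_gr_indep) tens_gr_full tens_act1 tens_actM
    tens_actJ.

End Tensor.

(* A set R_x of representatives of the left cosets of Cen(x). *)
Record coset_reps (x : gT) := CosetReps {
  repset :> {set gT};
  _ : is_transversal repset (lcosets 'C[x]%g [set: gT]) [set: gT] }.

Section Simple.
Variables (x : gT) (Rx : coset_reps x) (n : nat).
Variable rho : mx_representation C 'C[x]%g n.

Definition rep_index := {a : gT | a \in repset Rx}.

Lemma coset_repsP :
  is_transversal Rx (lcosets 'C[x]%g [set: gT]) [set: gT].
Proof. by case: Rx. Qed.

Lemma mem_lcosetsT z : (z *: 'C[x])%g \in lcosets 'C[x]%g [set: gT].
Proof. by apply/lcosetsP; exists z. Qed.

Fact coset_rep_subproof z : transversal_repr 1%g Rx (z *: 'C[x])%g \in repset Rx.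
Proof. exact: repr_mem_transversal coset_repsP _ _ (mem_lcosetsT z). Qed.

Definition coset_rep z : rep_index :=
  exist (fun a => a \in repset Rx) _ (coset_rep_subproof z).

Arguments coset_rep : simpl never.

Lemma coset_rep_mem z : ((val (coset_rep z))^-1 * z)%g \in ('C[x])%g.
Proof.
have := repr_mem_pblock coset_repsP 1%g (mem_lcosetsT z).
by rewrite mem_lcoset -groupV invMg invgK.
Qed.

Lemma coset_rep_uniq z (a : rep_index) :
  ((val a)^-1 * z)%g \in ('C[x])%g -> coset_rep z = a.
Proof.
move=> az; apply: val_inj.
have : val a \in (repset Rx :&: z *: 'C[x])%g.
  by rewrite inE (valP a) mem_lcoset -groupV invMg invgK.
by rewrite (setI_transversal_pblock coset_repsP 1%g (mem_lcosetsT z)) inE => /eqP.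
Qed.

Lemma coset_repM g z :
  coset_rep (g * z)%g = coset_rep (g * val (coset_rep z))%g.
Proof.
apply: coset_rep_uniq.
have -> : ((val (coset_rep (g * val (coset_rep z))))^-1 * (g * z) =
  ((val (coset_rep (g * val (coset_rep z))))^-1 * (g * val (coset_rep z))) *
  ((val (coset_rep z))^-1 * z))%g by rewrite !mulgA mulgK.
by rewrite groupM ?coset_rep_mem.
Qed.

(* The coordinate f a, for a in R_x, is the component of f in the copy of U(rho)
   sitting in degree a x a^-1; every y in the class of x is of this form for a
   unique a in R_x. rho acts on U(rho) = 'cV_n by left multiplication. *)
Definition simple_space := {ffun rep_index -> 'cV[C]_n}.

Definition simple_off (y : gT) (f : simple_space) : simple_space :=
  [ffun a => if (val a * x * (val a)^-1)%g == y then 0 else f a].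

(* With g a = a' b, a the representative of g^-1 a', the value at a' of L_g f is
   rho(b) applied to f a. *)
Definition simple_act_fun (g : gT) (f : simple_space) : simple_space :=
  [ffun a' => let a := coset_rep (g^-1 * val a')%g in
     rho ((val a')^-1 * g * val a)%g *m f a].

Fact simple_off_linear y : linear (simple_off y).
Proof.
move=> c f f'; apply/ffunP => a; rewrite !ffunE.
by case: ifP => _; rewrite ?scaler0 ?addr0.
Qed.

HB.instance Definition _ y :=
  GRing.isLinear.Build C simple_space simple_space *:%R (simple_off y)
    (simple_off_linear y).

Fact simple_act_linear g : linear (simple_act_fun g).
Proof.
by move=> c f f'; apply/ffunP => a; rewrite !ffunE /= !ffunE mulmxDr scalemxAr.
Qed.

HB.instance Definition _ g :=
  GRing.isLinear.Build C simple_space simple_space *:%R (simple_act_fun g)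
    (simple_act_linear g).

Definition simple_gr y : {vspace simple_space} := lker (linfun (simple_off y)).

Definition simple_act g : 'End(simple_space) := linfun (simple_act_fun g).

Lemma mem_simple_grP y (f : simple_space) :
  reflect (forall a, (val a * x * (val a)^-1)%g != y -> f a = 0)
          (f \in simple_gr y).
Proof.
rewrite memv_ker lfunE; apply: (iffP eqP) => [/ffunP Hf a /negbTE Ha | Hf].
  by have := Hf a; rewrite !ffunE Ha.
by apply/ffunP => a; rewrite !ffunE; case: eqP => // /eqP /Hf.
Qed.

Fact simple_gr_indep : grade_indep simple_gr.
Proof.
move=> us Hus s0 y; apply/ffunP => a; rewrite ffunE.
have [<-|Ha] := eqVneq (val a * x * (val a)^-1)%g y; last first.
  by apply: (mem_simple_grP _ _ (Hus y)).
move/ffunP/(_ a): s0; rewrite sum_ffunE ffunE.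
rewrite (bigD1 (val a * x * (val a)^-1)%g) //= big1 ?addr0 // => z Hz.
by apply: (mem_simple_grP _ _ (Hus z)); rewrite eq_sym.
Qed.

Fact simple_gr_full : (\sum_y simple_gr y)%VS = fullv.
Proof.
apply/vspaceP => f; rewrite memvf.
have -> : f = \sum_y [ffun a => if (val a * x * (val a)^-1)%g == y then f a else 0].
  apply/ffunP => a; rewrite sum_ffunE (bigD1 (val a * x * (val a)^-1)%g) //=.
  by rewrite ffunE eqxx big1 ?addr0 // => z Hz; rewrite ffunE eq_sym (negbTE Hz).
apply: memv_suml => y _; apply: (subvP (sumv_sup y _ (subvv _))) => //.
by apply/mem_simple_grP => a /negbTE Ha; rewrite ffunE Ha.
Qed.

Lemma simple_actE g f a :
  simple_act g f a = rho ((val a)^-1 * g * val (coset_rep (g^-1 * val a)))%g *m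
                     f (coset_rep (g^-1 * val a)%g).
Proof. by rewrite lfunE ffunE. Qed.

Lemma coset_rep_shift g z :
  (z^-1 * g * val (coset_rep (g^-1 * z)))%g \in ('C[x])%g.
Proof.
by have := coset_rep_mem (g^-1 * z)%g; rewrite -groupV !invMg !invgK.
Qed.

Fact simple_act1 : simple_act 1%g = \1%VF.
Proof.
apply/lfunP => f; rewrite id_lfunE; apply/ffunP => a; rewrite simple_actE.
have -> : coset_rep (1^-1 * val a)%g = a.
  by apply: coset_rep_uniq; rewrite invg1 mul1g mulVg group1.
by rewrite mulg1 mulVg repr_mx1 mul1mx.
Qed.

Fact simple_actM g h : simple_act (g * h)%g = (simple_act g \o simple_act h)%VF.
Proof.
apply/lfunP => f; rewrite comp_lfunE; apply/ffunP => a.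
rewrite !simple_actE invMg -[(h^-1 * g^-1 * _)%g]mulgA coset_repM mulmxA.
by rewrite -repr_mxM ?coset_rep_shift // !mulgA mulgK.
Qed.

Fact simple_actJ g y :
  (simple_act g @: simple_gr y)%VS = simple_gr (g * y * g^-1)%g.
Proof.
apply: dactJ_sub simple_act1 simple_actM _ g y => g y f /mem_simple_grP Hf.
apply/mem_simple_grP => a Ha; rewrite simple_actE Hf ?mulmx0 //.
apply: contraNneq Ha => <-; apply/eqP.
have /cent1P := coset_rep_shift g (val a).
set b := val (coset_rep _); set c := (_ * _ * b)%g => cx.
have Da : val a = (g * b * c^-1)%g.
  by rewrite /c !invMg invgK !mulgA mulgK mulgV mul1g.
have {cx}cx : (c^-1 * x * c)%g = x by rewrite -mulgA -cx mulKg.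
by clearbody c; rewrite Da !invMg invgK -[in RHS]cx !mulgA.
Qed.

(* U(x, rho), a simple object when rho is irreducible. *)
Definition dsimple : dobj :=
  DObj (grade_indep_direct simple_gr_indep) simple_gr_full simple_act1
    simple_actM simple_actJ.

End Simple.

End Objects.

Record SL2 (F : finFieldType) := SL2Elt {
  slmx :> 'M[F]_2;
  slmxP : \det slmx == 1 }.

HB.instance Definition _ (F : finFieldType) := [isSub for @slmx F].
HB.instance Definition _ (F : finFieldType) := [Finite of SL2 F by <:].

Section SL2Group.
Variable F : finFieldType.
Implicit Types A B : SL2 F.

Fact sl_one_subproof : \det (1%:M : 'M[F]_2) == 1.
Proof. by rewrite det1. Qed.
Definition sl_one := SL2Elt sl_one_subproof.

Fact sl_mul_subproof A B : \det (slmx A *m slmx B) == 1.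
Proof. by rewrite det_mulmx (eqP (slmxP A)) (eqP (slmxP B)) mulr1. Qed.
Definition sl_mul A B := SL2Elt (sl_mul_subproof A B).

Fact sl_inv_subproof A : \det (invmx (slmx A)) == 1.
Proof. by rewrite det_inv (eqP (slmxP A)) invr1. Qed.
Definition sl_inv A := SL2Elt (sl_inv_subproof A).

Fact sl_mulA : associative sl_mul.
Proof. by move=> A B D; apply: val_inj; rewrite /= mulmxA. Qed.

Fact sl_mul1 : left_id sl_one sl_mul.
Proof. by move=> A; apply: val_inj; rewrite /= mul1mx. Qed.

Fact sl_mulV : left_inverse sl_one sl_inv sl_mul.
Proof.
move=> A; apply: val_inj; rewrite /= mulVmx //.
by rewrite unitmxE (eqP (slmxP A)) unitr1.
Qed.

HB.instance Definition _ :=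
  Finite_isGroup.Build (SL2 F) sl_mulA sl_mul1 sl_mulV.

Definition mat2 (a b c d : F) : 'M[F]_2 :=
  \matrix_(i < 2, j < 2) (nth [::] [:: [:: a; b]; [:: c; d]] i)`_j.

Lemma mat2_eta (M : 'M[F]_2) : M = mat2 (M 0 0) (M 0 1) (M 1 0) (M 1 1).
Proof.
apply/matrixP => i j; rewrite mxE.
by case: i => [[|[|//]] ?]; case: j => [[|[|//]] ?] /=; congr (M _ _); apply: val_inj.
Qed.

Lemma mat2_inj a b c d a' b' c' d' :
  mat2 a b c d = mat2 a' b' c' d' -> [/\ a = a', b = b', c = c' & d = d'].
Proof. by move/matrixP => H; move: (H 0 0) (H 0 1) (H 1 0) (H 1 1); rewrite !mxE. Qed.

Lemma mul_mat2 a b c d a' b' c' d' :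
  mat2 a b c d *m mat2 a' b' c' d' =
  mat2 (a * a' + b * c') (a * b' + b * d') (c * a' + d * c') (c * b' + d * d').
Proof. by rewrite [LHS]mat2_eta !mxE !big_ord_recl !big_ord0 !mxE /= !addr0. Qed.

Lemma det_mat2 a b c d : \det (mat2 a b c d) = a * d - b * c.
Proof.
rewrite (expand_det_row _ 0) !big_ord_recl big_ord0 addr0 /cofactor !det_mx11 !mxE /=.
by rewrite expr0 expr1 mul1r mulN1r mulrN.
Qed.

Lemma slmx_inj : injective (@slmx F).
Proof. exact: val_inj. Qed.

Lemma slmxM A B : slmx (A * B)%g = slmx A *m slmx B.
Proof. by []. Qed.

Lemma slmx1 : slmx 1%g = mat2 1 0 0 1.
Proof. by rewrite [LHS]mat2_eta !mxE. Qed.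

Fact sl_diag_subproof (e : {unit F}) : \det (mat2 (val e) 0 0 (val e)^-1) == 1.
Proof. by rewrite det_mat2 mul0r subr0 mulrV // (valP e). Qed.
Definition sl_diag e := SL2Elt (sl_diag_subproof e).

Fact sl_unip_subproof (y : F) : \det (mat2 1 y 0 1) == 1.
Proof. by rewrite det_mat2 mulr0 subr0 mulr1. Qed.
Definition sl_unip y := SL2Elt (sl_unip_subproof y).

Fact sl_sign_subproof (s : bool) :
  \det (mat2 ((-1) ^+ s) 0 0 ((-1) ^+ s)) == 1.
Proof. by rewrite det_mat2 mul0r subr0 -expr2 sqrr_sign. Qed.
Definition sl_sign s := SL2Elt (sl_sign_subproof s).

(* mu b_eps. Signs are booleans, with true standing for -, so that the coercion
   of bool to nat is the acute map + |-> 0, - |-> 1, and the sign s, seen as an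
   element of a ring, is (-1) ^+ s. *)
Definition sl_bb (e : {unit F}) (mu eps : bool) : SL2 F :=
  (sl_sign mu * sl_unip (val e ^+ eps)%R)%g.

Lemma sl_diagX (e : {unit F}) k :
  slmx (sl_diag e ^+ k)%g = mat2 (val e ^+ k) 0 0 (val e ^- k).
Proof.
elim: k => [|k IH]; first by rewrite expg0 slmx1 expr0 invr1.
rewrite expgS slmxM IH /= mul_mat2 !mulr0 !mul0r !addr0 !add0r.
by rewrite exprS invfM.
Qed.

Lemma sl_signM_unip s y : slmx (sl_sign s * sl_unip y)%g =
  mat2 ((-1) ^+ s) ((-1) ^+ s * y) 0 ((-1) ^+ s).
Proof.
by rewrite slmxM /= mul_mat2 !mulr0 !mul0r !addr0 !add0r !mulr1.
Qed.


Lemma card_units : #|[set: {unit F}]| = #|F|.-1.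
Proof. exact: card_finField_unit. Qed.

Lemma order_gen (e : {unit F}) : generator [set: {unit F}] e -> #[e]%g = #|F|.-1.
Proof. by move/eqP => ge; rewrite /order -ge card_units. Qed.

Lemma unitX (e : {unit F}) k : val (e ^+ k)%g = val e ^+ k.
Proof. by rewrite FinRing.val_unitX. Qed.

Lemma sl_diagX_eq (e : {unit F}) i j :
  ((sl_diag e ^+ i)%g == (sl_diag e ^+ j)%g) = (i == j %[mod #[e]%g]).
Proof.
rewrite -eq_expg_mod_order; apply/eqP/eqP => [/(congr1 (@slmx F))|].
  rewrite !sl_diagX => /mat2_inj [eij _ _ _].
  by apply: val_inj; rewrite /= !unitX.
move/(congr1 val); rewrite /= !unitX => eij.
by apply: val_inj; rewrite /= !sl_diagX eij.
Qed.

Lemma cent_diagX (e : {unit F}) h k A :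
  generator [set: {unit F}] e -> #|F| = (4 * h + 1)%N ->
  (1 <= k <= 2 * h - 1)%N -> A \in 'C[sl_diag e ^+ k]%g ->
  exists i, A = (sl_diag e ^+ i)%g.
Proof.
move=> ge Fh hk /cent1P /(congr1 (@slmx F)).
rewrite !slmxM !sl_diagX [slmx A]mat2_eta !mul_mat2 => /mat2_inj [_].
set b := slmx A 0 1; set c := slmx A 1 0.
rewrite !mulr0 !mul0r !addr0 !add0r.
set x := val e ^+ k => bx cx _.
have xV : x != x^-1.
  have x0 : x != 0 by rewrite expf_neq0 // -unitfE (valP e).
  rewrite -subr_eq0; apply/negP => /eqP x2.
  have : x * x = 1 by apply/eqP; rewrite -(mulfV x0) -subr_eq0 -mulrBr x2 mulr0.
  rewrite -exprD -unitX => e1.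
  have : (e ^+ (k + k) == 1)%g by apply/eqP/val_inj.
  rewrite -order_dvdn (order_gen ge) Fh => /dvdn_leq.
  lia.
have b0 : b = 0.
  apply/eqP; have : b * (x^-1 - x) = 0 by rewrite mulrBr bx [x * b]mulrC subrr.
  by move/eqP; rewrite mulf_eq0 subr_eq0 [_ == x]eq_sym (negbTE xV) orbF.
have c0 : c = 0.
  apply/eqP; have : c * (x - x^-1) = 0 by rewrite mulrBr cx [_^-1 * c]mulrC subrr.
  by move/eqP; rewrite mulf_eq0 subr_eq0 (negbTE xV) orbF.
have := eqP (slmxP A); rewrite [slmx A]mat2_eta det_mat2 -/b -/c b0 c0 mul0r subr0 => ad.
have aU : slmx A 0 0 \is a GRing.unit.
  by rewrite unitfE; apply: contra_eq_neq ad => ->; rewrite mul0r eq_sym oner_eq0.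
have : FinRing.unit F aU \in [set: {unit F}] by rewrite inE.
rewrite (eqP ge) => /cycleP [i /(congr1 val)]; rewrite /= unitX => ai.
exists i; apply: val_inj; rewrite /= sl_diagX [slmx A]mat2_eta -/b -/c b0 c0 ai.
by congr mat2; rewrite -ai; apply: (mulrI aU); rewrite ad mulrV.
Qed.

Lemma cent_bb (e : {unit F}) mu eps A : A \in 'C[sl_bb e mu eps]%g ->
  exists s c, A = (sl_sign s * sl_unip c)%g.
Proof.
move=> /cent1P /(congr1 (@slmx F)); rewrite [slmx (A * _)%g]slmxM.
rewrite [slmx (_ * A)%g]slmxM /sl_bb !sl_signM_unip.
rewrite [slmx A]mat2_eta !mul_mat2 => /mat2_inj [aa bb _ _].
set a := slmx A 0 0 in aa bb *; set b := slmx A 0 1 in aa bb *.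
set c := slmx A 1 0 in aa bb *; set d := slmx A 1 1 in aa bb *.
set y := val e ^+ eps in aa bb.
have yU : (-1) ^+ mu * y \is a GRing.unit.
  by rewrite unitrM unitrX ?unitrN1 // unitrX // (valP e).
have c0 : c = 0.
  move: aa; rewrite mulr0 addr0 mulrC => /eqP.
  rewrite -subr_eq0 opprD addrA subrr add0r oppr_eq0 => /eqP yc.
  by apply: (mulrI yU); rewrite yc mulr0.
have da : d = a.
  apply: (mulrI yU); apply/(addrI ((-1) ^+ mu * b)); rewrite -bb.
  by rewrite addrC [b * _]mulrC [a * _]mulrC.
have := eqP (slmxP A); rewrite [slmx A]mat2_eta det_mat2 -/a -/b -/c -/d c0 da mulr0 subr0.
move/eqP; rewrite -expr2 sqrf_eq1 => aS.
have {}aS : a = (-1) ^+ (a != 1).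
  by case: eqVneq aS => [-> //|_ /=]; rewrite expr1 => /eqP.
exists (a != 1), (a * b); apply: slmx_inj; rewrite sl_signM_unip -aS [LHS]mat2_eta.
rewrite -/a -/b -/c -/d c0 da; congr mat2.
by rewrite mulrA {1 2}aS -expr2 sqrr_sign mul1r.
Qed.

End SL2Group.

Section RootsOfUnity.
Variable R : realType.

(* exp(2 pi i / m) *)
Definition zeta (m : nat) : R[i] :=
  (cos (pi *+ 2 / m%:R) +i* sin (pi *+ 2 / m%:R))%C.

Lemma zetaX m k : zeta m ^+ k =
  (cos (pi *+ 2 / m%:R *+ k) +i* sin (pi *+ 2 / m%:R *+ k))%C.
Proof.
rewrite /zeta; set x := pi *+ 2 / _.
elim: k => [|k IH]; first by rewrite expr0 mulr0n cos0 sin0.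
rewrite exprS IH mulrS cosD sinD; apply/eqP; rewrite eq_complex /=.
by rewrite eqxx [sin _ * _ + _]addrC eqxx.
Qed.

Lemma zetaXm m : (0 < m)%N -> zeta m ^+ m = 1.
Proof.
move=> m0; rewrite zetaX -[_ / _ *+ m]mulr_natr divfK ?pnatr_eq0 -?lt0n //.
by rewrite cos2pi sin2pi.
Qed.

Lemma zeta_mod m i j : (0 < m)%N -> i = j %[mod m] -> zeta m ^+ i = zeta m ^+ j.
Proof.
by move=> m0 ij; rewrite -(expr_mod i (zetaXm m0)) ij expr_mod // zetaXm.
Qed.

End RootsOfUnity.

Section FieldTrace.
Variables (F : finFieldType) (p : nat) (hp : p \in [pchar F]).

(* The library trace lies in the prime subfield 1%VS of F; its coordinate on
   the basis (1) is the corresponding element of 'F_p. *)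
Definition trFp (c : F) : 'F_p :=
  coord [tuple (1 : pPrimeCharType hp)] 0
    (galTrace 1%VS {:pPrimeCharType hp} (c : pPrimeCharType hp)).

Lemma trFpE c :
  (trFp c)%:A = galTrace 1%VS {:pPrimeCharType hp} (c : pPrimeCharType hp).
Proof.
set t := galTrace _ _ _.
have : t \in <<[tuple (1 : pPrimeCharType hp)%R]>>%VS.
  rewrite span_seq1; apply: (@mem_galTrace _ _ 1%AS {:pPrimeCharType hp}%AS).
    by apply: finField_galois; exact: subvf.
  exact: memvf.
by move/coord_span; rewrite big_ord1 /= => ->.
Qed.

Lemma trFpD : {morph trFp : c d / c + d}.
Proof.
by move=> c d; rewrite /trFp -linearD /= -(raddfD (galTrace _ _)).
Qed.

Lemma trFp0 : trFp 0 = 0.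
Proof. by rewrite /trFp raddf0 linear0. Qed.

End FieldTrace.

Section SimpleObjects.
Variables (R : realType) (F : finFieldType).

Section Characters.
Variable e : {unit F}.

(* u^*(a^i) = zeta_(q-1)^(i u); see ustarE. *)
Definition ustar (u : 'Z_(#|F|.-1)) (M : SL2 F) : 'M[R[i]]_1 :=
  if [pick i : 'I_(#|F|.-1) | M == sl_diag e ^+ i]%g is Some i
  then (zeta R #|F|.-1 ^+ (i * u))%:M else 0.

Variable h : nat.
Hypotheses (ge : generator [set: {unit F}] e) (Fh : #|F| = (4 * h + 1)%N).

Lemma ustarE u i : (0 < h)%N ->
  ustar u (sl_diag e ^+ i)%g = (zeta R #|F|.-1 ^+ (i * u))%:M.
Proof.
move=> h0; have F1 : (0 < #|F|.-1)%N by rewrite Fh; lia.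
rewrite /ustar; case: pickP => [j|/(_ (Ordinal (ltn_pmod i F1)))].
  rewrite sl_diagX_eq (order_gen ge) => /eqP ij.
  by congr (_%:M); apply: zeta_mod => //; rewrite -modnMml -ij modnMml.
by rewrite sl_diagX_eq (order_gen ge) /= modn_mod eqxx.
Qed.

Fact ustar_repr_subproof k u : (1 <= k <= 2 * h - 1)%N ->
  mx_repr 'C[sl_diag e ^+ k]%g (ustar u).
Proof.
move=> hk; have h0 : (0 < h)%N by lia.
split=> [|A B /(cent_diagX ge Fh hk) [i ->] /(cent_diagX ge Fh hk) [j ->]].
  by rewrite -(expg0 (sl_diag e)) ustarE.
by rewrite -expgD !ustarE // -scalar_mxM mulnDl exprD.
Qed.

Definition ustar_repr k u (hk : (1 <= k <= 2 * h - 1)%N) :=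
  MxRepresentation (ustar_repr_subproof u hk).

(* A_k^u = U(a^k, u^* ) *)
Definition Aobj k (hk : (1 <= k <= 2 * h - 1)%N) u
    (Rx : coset_reps (sl_diag e ^+ k)%g) : dobj R[i] (SL2 F) :=
  dsimple Rx (ustar_repr u hk).

End Characters.

Variables (p : nat) (hp : p \in [pchar F]).

(* (nu, v)^*: for M = eta b(c) one has eta = M 0 0 and c = M 0 1 / M 0 0; see
   bstarE. *)
Definition bstar (nu : bool) (v : F) (M : SL2 F) : 'M[R[i]]_1 :=
  (((-1) ^+ (slmx M 0 0 != 1)) ^+ nu *
   zeta R p ^+ trFp hp (v * (slmx M 0 1 / slmx M 0 0)))%:M.

Lemma bstar_sign_unip nu v s c : bstar nu v (sl_sign F s * sl_unip c)%g =
  (((-1) ^+ ((-1) ^+ s != 1 :> F)) ^+ nu * zeta R p ^+ trFp hp (v * c))%:M.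
Proof.
rewrite /bstar sl_signM_unip !mxE /=; congr (_ * _ ^+ trFp hp (v * _))%:M.
by rewrite [_ * c]mulrC mulfK ?signr_eq0.
Qed.

Lemma bstarE nu v s c : odd p ->
  bstar nu v (sl_sign F s * sl_unip c)%g =
  (((-1) ^+ s) ^+ nu * zeta R p ^+ trFp hp (v * c))%:M.
Proof.
move=> podd; have F2 : (-1 : F) != 1.
  rewrite eq_sym -subr_eq0 opprK -mulr2n -(dvdn_pcharf hp).
  apply/negP => /dvdn_leq => /(_ isT).
  by have := prime_gt1 (pcharf_prime hp); case: (p) podd => [|[|[|[]]]].
rewrite bstar_sign_unip; congr (_ ^+ _ * _)%:M.
by case: s; rewrite ?expr0 ?eqxx // expr1 F2.
Qed.

Lemma zeta_trD c d : zeta R p ^+ trFp hp (c + d) =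
  zeta R p ^+ trFp hp c * zeta R p ^+ trFp hp d.
Proof.
have pr : prime p := pcharf_prime hp.
rewrite trFpD -exprD; apply: zeta_mod; first exact: prime_gt0.
rewrite /=; move: (_ + _)%N => m; by rewrite Fp_cast // modn_mod.
Qed.

Lemma mul_sign_unip s c s' c' :
  (sl_sign F s * sl_unip c * (sl_sign F s' * sl_unip c') =
   sl_sign F (s (+) s') * sl_unip (c + c'))%g.
Proof.
apply: slmx_inj; rewrite [LHS]slmxM !sl_signM_unip mul_mat2 signr_addb.
rewrite !mulr0 !mul0r !addr0 !add0r; congr mat2.
by rewrite mulrDr mulrA addrC -!mulrA [c * _]mulrC.
Qed.

Fact bstar_repr_subproof e mu eps nu v :
  mx_repr 'C[sl_bb e mu eps]%g (bstar nu v).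
Proof.
split=> [|A B /cent_bb [s [c ->]] /cent_bb [s' [c' ->]]].
  by rewrite /bstar slmx1 !mxE /= eqxx expr0 expr1n mul0r mulr0 trFp0 expr0 mulr1.
rewrite mul_sign_unip !bstar_sign_unip -scalar_mxM mulrDr zeta_trD.
rewrite mulrACA -exprMn; congr (_ ^+ _ * _)%:M.
by case: s; case: s'; rewrite /= ?expr0 ?expr1 ?eqxx ?mulr1 ?mul1r // -expr2 sqrr_sign.
Qed.

Definition bstar_repr e mu eps nu v :=
  MxRepresentation (bstar_repr_subproof e mu eps nu v).

(* B_(mu,eps)^(nu,v) = U(mu b_eps, (nu, v)^* ) *)
Definition Bobj e mu eps nu v (Rx : coset_reps (sl_bb e mu eps)) :
  dobj R[i] (SL2 F) := dsimple Rx (bstar_repr e mu eps nu v).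

End SimpleObjects.

Lemma e_generator (F K : finFieldType) h (iota : {rmorphism F -> K})
    (ce : {unit K}) (e : {unit F}) :
  #|F| = (4 * h + 1)%N -> #|K| = (#|F| ^ 2)%N ->
  generator [set: {unit K}] ce ->
  iota (val e) = val ce ^+ (4 * h + 2) ->
  generator [set: {unit F}] e.
Proof.
move=> Fh cK gce he.
have F1 : (1 < #|F|)%N by exact: finNzRing_gt1.
have h0 : (0 < h)%N by move: F1; rewrite Fh; lia.
have oc : #[ce]%g = (4 * h * (4 * h + 2))%N.
  by rewrite (order_gen gce) cK Fh; nia.
have ox : #[ce ^+ (4 * h + 2)]%g = (4 * h)%N.
  by rewrite orderXdiv oc ?dvdn_mull // mulnK //; lia.
have dv : (4 * h %| #[e]%g)%N.
  rewrite -ox order_dvdn; apply/eqP/val_inj; rewrite /= !FinRing.val_unitX -he.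
  by rewrite -rmorphXn -FinRing.val_unitX expg_order rmorph1.
rewrite /generator eq_sym eqEcard subsetT /= card_units Fh addn1 /=.
by apply: dvdn_leq dv; exact: order_gt0.
Qed.

Section Parity.
Variables (R : realType) (F : finFieldType).

(* By Schur's lemma rho (-1) is either 1 or -1 when rho is irreducible. *)
Definition rep_even x n (rho : mx_representation R[i] 'C[x : SL2 F]%g n) : bool :=
  rho (sl_sign F true) == 1%:M.

End Parity.

(* Main.v *)
Require Import Defs.
From HB Require Import structures.
From mathcomp Require Import all_boot all_order all_algebra all_fingroup.
From mathcomp Require Import all_solvable all_field mxrepresentation.
From mathcomp Require Import complex reals trigo zify ring lra.

Set Implicit Arguments.
Unset Strict Implicit.
Unset Printing Implicit Defensive.

Import Order.TTheory GRing.Theory Num.Theory.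
Local Open Scope ring_scope.

(** Write [x = mu b_eps]. If [y z = x] with [y] in the class of [a^k1] and [z] in
    that of [a^k2], comparing traces gives [tr z = mu (tr y - y_10 b)], where [b]
    is the upper right entry of [b_eps]; since [t1 = mu t2] this forces [y] to be
    upper triangular with diagonal [e^k1, e^-k1] or [e^-k1, e^k1]. So there are
    [2q] such pairs, and conjugation by the unipotent subgroup of [Cen(x)] has two
    free orbits on them. Each pair carries a line of [X_x], hence [X_x] is twice
    the regular representation of [F_q], on which [-1] acts by the sign [nu].
    Averaging an orbit against the additive characters [psi(v c)] yields
    [Cen(x)]-eigenvectors [w_v] of character [(nu, v)^*] that span [X_x]. By
    Frobenius reciprocity each of them induces a morphism from [B^(nu,v)] to [X];
    together these map the right-hand side onto [X_[x]], and the dimensions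
    agree. *)

(** * Morphisms, surjections and dimensions in the category of graded objects *)

Section Morphisms.
Variables (C : fieldType) (gT : finGroupType).
Implicit Types U V W : dobj C gT.

Lemma dmorphism_mem U V (f : 'Hom(U, V)) x u :
  dmorphism f -> u \in dgr U x -> f u \in dgr V x.
Proof. by case=> fgr _ ux; apply: (subvP (fgr x)); exact: memv_img. Qed.

Lemma dmorphism_act U V (f : 'Hom(U, V)) g u :
  dmorphism f -> f (dact U g u) = dact V g (f u).
Proof. by case=> _ fact; rewrite -!comp_lfunE fact. Qed.

Lemma dmorphismP U V (f : 'Hom(U, V)) :
  (forall x u, u \in dgr U x -> f u \in dgr V x) ->
  (forall g u, f (dact U g u) = dact V g (f u)) -> dmorphism f.
Proof.
move=> fgr fact; split=> [x|g]; last by apply/lfunP=> u; rewrite !comp_lfunE fact.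
by apply/subvP => _ /memv_imgP [u ux ->]; exact: fgr.
Qed.

(** Equivariance passes to the inverse at once. For the grading, split the preimage of a vector [v]
    of degree [x] into homogeneous components: by independence of the degrees of [V], those of
    degree other than [x] have zero image. *)
Lemma dmorphism_inv U V (f : 'Hom(U, V)) :
  dmorphism f -> lker f == 0%VS -> limg f = fullv -> dmorphism f^-1%VF.
Proof.
move=> fM fker fimg.
have fK : cancel f f^-1%VF by exact: lker0_lfunK.
have fVK : cancel f^-1%VF f by move=> v; rewrite limg_lfunVK // fimg memvf.
have finj : injective f := can_inj fK.
apply: dmorphismP => [x v vx|g v]; last first.
  by apply: finj; rewrite fVK dmorphism_act // fVK.
have [us Hus Dv] := dgr_decomp (f^-1%VF v).
have fDv : f (\sum_z us z) = v by rewrite -Dv fVK.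
rewrite Dv (bigD1 x) //= big1 ?addr0 // => y /negbTE yx.
(* These are the homogeneous components of [f (\sum_z us z) - v], which is zero. *)
pose vs z := f (us z) - (if z == x then v else 0).
have vs0 : vs y = 0.
  apply: (dgr_indep (us := vs)) => [z|].
    by rewrite /vs rpredB ?dmorphism_mem //; case: eqP => [->|_] //; exact: mem0v.
  by rewrite sumrB -big_mkcond big_pred1_eq -fDv linear_sum subrr.
by apply: finj; move: vs0; rewrite /vs yx subr0 linear0.
Qed.

Lemma disom_onto U V (f : 'Hom(V, U)) :
  dmorphism f -> limg f = fullv -> (dim V <= dim U)%N -> disom U V.
Proof.
move=> fM fimg leVU.
have fker : lker f == 0%VS.
  have := limg_ker_dim f fullv; rewrite capfv fimg !dimvf => dimf.
  by rewrite -dimv_eq0; apply/eqP; lia.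
exists f^-1%VF, f; split=> //; first exact: dmorphism_inv.
  by apply/lfunP => u; rewrite comp_lfunE id_lfunE limg_lfunVK // fimg memvf.
exact: lker0_compVf.
Qed.

(** Recording the image and the dimension of the source makes surjections additive even when the
    images are not known to be independent. Injectivity is recovered once, at the end, by comparing
    dimensions. *)
Definition covers U (W : {vspace U}) (d : nat) V :=
  exists f : 'Hom(V, U), [/\ dmorphism f, limg f = W & dim V = d].

Lemma covers_dzero U : covers (0 : {vspace U})%VS 0 (dzero C gT).
Proof.
exists 0; split=> //; last by rewrite lim0g.
by apply: dmorphismP => [x u _|g u]; rewrite !zero_lfunE ?mem0v ?linear0.
Qed.

Lemma covers_dsum U (W1 W2 : {vspace U}) d1 d2 V1 V2 :
  covers W1 d1 V1 -> covers W2 d2 V2 ->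
  covers (W1 + W2)%VS (d1 + d2) (dsum V1 V2).
Proof.
case=> f1 [fM1 <- <-] [f2 [fM2 <- <-]].
pose p1 : 'Hom((V1 * V2)%type, V1) := linfun fst.
pose p2 : 'Hom((V1 * V2)%type, V2) := linfun snd.
pose f : 'Hom(dsum V1 V2, U) := (f1 \o p1)%VF + (f2 \o p2)%VF.
have fE w : f w = f1 w.1 + f2 w.2 by rewrite add_lfunE !comp_lfunE !lfunE.
exists f; split=> //.
  apply: dmorphismP => [x w|g w]; rewrite !fE.
    by rewrite mem_dsum_gr => /andP [w1 w2]; rewrite rpredD // dmorphism_mem.
  by rewrite lfunE /= /dsum_act_fun /= !dmorphism_act // linearD.
apply/vspaceP => u; apply/memv_imgP/memv_addP.
  by case=> w _ ->; rewrite fE; exists (f1 w.1); [|exists (f2 w.2)]; rewrite ?memv_img ?memvf.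
case=> _ /memv_imgP [v1 _ ->] [_ /memv_imgP [v2 _ ->] ->].
by exists (v1, v2); rewrite ?memvf ?fE.
Qed.

Lemma covers_bigdsum U (I : Type) (r : seq I) (W : I -> {vspace U}) d (V : I -> dobj C gT) :
  (forall i, covers (W i) (d i) (V i)) ->
  covers (\sum_(i <- r) W i)%VS (\sum_(i <- r) d i)%N
    (\big[@dsum C gT / @dzero C gT]_(i <- r) V i).
Proof.
move=> cW; apply: (big_ind3 (@covers U)) => [|W1 d1 V1 W2 d2 V2|i _].
- exact: covers_dzero.
- exact: covers_dsum.
- exact: cW.
Qed.

Lemma disom_dsupp U x d V :
  covers (supp_space U x) d V -> (d <= \dim (supp_space U x))%N ->
  disom (dsupp U x) V.
Proof.
case=> f [fM fimg <-] dimV.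
have fS v : f v \in supp_space U x by rewrite -fimg memv_img ?memvf.
pose f' : 'Hom(V, dsupp U x) := (linfun (vsproj (supp_space U x)) \o f)%VF.
have f'E v : vsval (f' v) = f v by rewrite comp_lfunE lfunE /= vsprojK.
apply: (@disom_onto _ _ f') => //.
  apply: dmorphismP => [y v vy|g v].
    by rewrite mem_supp_gr f'E dmorphism_mem.
  by apply: val_inj; rewrite /= val_supp_act !f'E dmorphism_act.
apply/vspaceP => w; rewrite memvf.
have: vsval w \in limg f by rewrite fimg subvsP.
case/memv_imgP => v _ Dw; apply/memv_imgP; exists v; rewrite ?memvf //.
by apply: val_inj; rewrite /= f'E.
Qed.

Lemma dact_inv U g : cancel (dact U g) (dact U g^-1%g).
Proof. by move=> u; rewrite -comp_lfunE -dactM mulVg dact1 id_lfunE. Qed.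

Lemma dim_dgrJ U g x : \dim (dgr U (g * x * g^-1)%g) = \dim (dgr U x).
Proof.
rewrite -dactJ limg_dim_eq //.
have /eqP -> : lker (dact U g) == 0%VS by apply/lker0P; exact: can_inj (dact_inv g).
by rewrite capv0.
Qed.

Lemma mem_classT (x y : gT) :
  reflect (exists g, y = (g * x * g^-1)%g) (y \in (x ^: [set: gT])%g).
Proof.
apply: (iffP imsetP) => [[g _ ->]|[g ->]].
  by exists g^-1%g; rewrite conjgE invgK mulgA.
by exists g^-1%g; rewrite ?inE // conjgE invgK mulgA.
Qed.

Lemma dim_supp_space U x :
  \dim (supp_space U x) = (#|(x ^: [set: gT])%g| * \dim (dgr U x))%N.
Proof.
have /directvP /= -> : directv (\sum_(y in (x ^: [set: gT])%g) dgr U y).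
  apply/directv_sum_independent => us Hus s0 y yx.
  pose vs z := if z \in (x ^: [set: gT])%g then us z else 0.
  have <- : vs y = us y by rewrite /vs yx.
  apply: (dgr_indep (us := vs)) => [z|]; last by rewrite -big_mkcond.
  by rewrite /vs; case: ifP => [/Hus //|_]; exact: mem0v.
rewrite -sum_nat_const; apply: eq_bigr => y /mem_classT [g ->].
by rewrite dim_dgrJ.
Qed.

(** In each degree the right-hand side is an upper bound, by [dim_tensv]. Summed over all degrees
    both sides give [dim U * dim V], so every one of these inequalities is an equality. *)
Lemma dim_tens_gr U V x :
  \dim (tens_gr U V x) =
  (\sum_(yz : gT * gT | (yz.1 * yz.2)%g == x)
     \dim (dgr U yz.1) * \dim (dgr V yz.2))%N.
Proof.
pose d x := (\sum_(yz : gT * gT | (yz.1 * yz.2)%g == x)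
     \dim (dgr U yz.1) * \dim (dgr V yz.2))%N.
have le_d y : (\dim (tens_gr U V y) <= d y)%N.
  apply: (@leq_trans (\sum_(yz : gT * gT | (yz.1 * yz.2)%g == y)
    \dim (tensv (dgr U yz.1) (dgr V yz.2)))); first exact: dimv_leq_sum.
  by apply: leq_sum => yz _; exact: dim_tensv.
have := leqif_sum (P := xpredT) (fun y _ => leqif_eq (le_d y)).
have -> : (\sum_y \dim (tens_gr U V y) = \sum_y d y)%N.
  have -> : (\sum_y \dim (tens_gr U V y) = dim U * dim V)%N.
    exact: sum_dim_dgr (dtens U V).
  rewrite [RHS](exchange_big_dep xpredT) //=.
  rewrite -!sum_dim_dgr big_distrlr /= pair_bigA /=; apply: eq_bigr => yz _.
  by rewrite (big_pred1 (yz.1 * yz.2)%g) // => z; rewrite /= eq_sym.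
by case=> _; rewrite eqxx => /esym/forallP/(_ x)/eqP.
Qed.

End Morphisms.

(** * Frobenius reciprocity for characters of a centralizer *)

Section InducedMorphisms.
Variables (C : fieldType) (gT : finGroupType) (x : gT) (Rx : coset_reps x).
Implicit Types (U : dobj C gT) (n : nat).

Lemma mem_cent1_conj (a g : gT) :
  ((a^-1 * g)%g \in 'C[x]%g) = ((a * x * a^-1)%g == (g * x * g^-1)%g).
Proof.
rewrite cent1E -(inj_eq (mulgI a)) -(inj_eq (mulIg g^-1)%g) !mulgA.
by rewrite mulgK mulgV mul1g eq_sym.
Qed.

Lemma coset_rep_val (a : rep_index Rx) : coset_rep Rx (val a) = a.
Proof. by apply: coset_rep_uniq; rewrite mulVg group1. Qed.

Lemma card_rep_index : #|{: rep_index Rx}| = #|(x ^: [set: gT])%g|.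
Proof.
have := index_cent1 [set: gT]%G x; rewrite /= setTI => <-.
rewrite -card_lcosets -(card_transversal (coset_repsP Rx)) card_sig.
by apply: eq_card => a.
Qed.

Lemma sum_dact_rep U :
  (\sum_(a : rep_index Rx) dact U (val a) @: dgr U x)%VS = supp_space U x.
Proof.
apply/eqP; rewrite eqEsubv; apply/andP; split; apply/subv_sumP.
  move=> a _; rewrite dactJ; apply: (sumv_sup (val a * x * (val a)^-1)%g) => //.
  by apply/mem_classT; exists (val a).
move=> _ /mem_classT [g ->].
apply: (sumv_sup (coset_rep Rx g)) => //; rewrite dactJ.
have := coset_rep_mem Rx g; rewrite mem_cent1_conj => /eqP ->.
exact: subvv.
Qed.

Lemma dim_dsimple n (rho : mx_representation C 'C[x]%g n) :
  dim (dsimple Rx rho) = (#|(x ^: [set: gT])%g| * n)%N.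
Proof. by rewrite /dim /= /dim /= card_rep_index muln1. Qed.

Lemma dact_dsimple_central n (rho : mx_representation C 'C[x]%g n) z c f :
  (forall g, commute z g) -> rho z = c%:M -> dact (dsimple Rx rho) z f = c *: f.
Proof.
move=> zC rz; apply/ffunP => a; rewrite simple_actE.
have zx : z \in 'C[x]%g by exact/cent1P/zC.
have -> : coset_rep Rx (z^-1 * val a)%g = a.
  apply: coset_rep_uniq; rewrite -(commuteV (commute_sym (zC _))) mulKg.
  by rewrite groupV.
by rewrite -[(_^-1 * z)%g]zC mulgKV rz mul_scalar_mx ffunE.
Qed.

Section Induced.
Variables (rho : mx_representation C 'C[x]%g 1) (U : dobj C gT) (w : U).

(** The map that Frobenius reciprocity attaches to [w]; it becomes a morphism once [w] has degree
    [x] and is a [rho]-eigenvector of Cen(x). *)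
Definition induced_fun (f : dsimple Rx rho) : U :=
  \sum_(a : rep_index Rx) f a 0 0 *: dact U (val a) w.

Fact induced_fun_linear : linear induced_fun.
Proof.
move=> c f f'; rewrite /induced_fun scaler_sumr -big_split /=.
by apply: eq_bigr => a _; rewrite !ffunE !mxE scalerDl scalerA.
Qed.

HB.instance Definition _ :=
  GRing.isLinear.Build C (dsimple Rx rho) U *:%R induced_fun induced_fun_linear.

Definition induced : 'Hom(dsimple Rx rho, U) := linfun induced_fun.

Lemma inducedE f :
  induced f = \sum_(a : rep_index Rx) f a 0 0 *: dact U (val a) w.
Proof. by rewrite lfunE. Qed.

Hypothesis w_x : w \in dgr U x.
Hypothesis w_rho : {in 'C[x]%g, forall b, dact U b w = rho b 0 0 *: w}.

Lemma induced_morphism : dmorphism induced.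
Proof.
apply: dmorphismP => [y f /mem_simple_grP fy|g f]; rewrite !inducedE.
  apply: memv_suml => a _.
  have [<-|/fy ->] := eqVneq (val a * x * (val a)^-1)%g y.
    by rewrite memvZ // mem_dact.
  by rewrite mxE scale0r mem0v.
rewrite linear_sum.
(* Left translation permutes the cosets of Cen(x); [s g] is this permutation read on
   representatives, with inverse [s g^-1]. *)
pose s g (a : rep_index Rx) := coset_rep Rx (g * val a)%g.
have sK a : s g (s g^-1%g a) = a by rewrite /s -coset_repM mulKVg coset_rep_val.
have sVK a : s g^-1%g (s g a) = a by rewrite /s -coset_repM mulKg coset_rep_val.
rewrite (reindex (s g)); last by exists (s g^-1%g) => a _.
apply: eq_bigr => a _; rewrite simple_actE -/(s g^-1%g _) sVK.
(* This is the [b] of [g a = a' b] with [a' = s g a]. The factor [rho b] in the action on [f] is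
   absorbed by the eigenvector [w]. *)
set b := (_ * _ * _)%g.
have bx : b \in 'C[x]%g by rewrite /b -mulgA coset_rep_mem.
have -> : val (s g a) = (g * val a * b^-1)%g.
  by rewrite /b -(mulgA _ g) invMg mulKVg invgK.
have bw : rho b 0 0 *: dact U (g * val a * b^-1)%g w = dact U g (dact U (val a) w).
  transitivity (dact U (g * val a * b^-1)%g (rho b 0 0 *: w)).
    by rewrite linearZ.
  by rewrite -w_rho // -!comp_lfunE -!dactM mulgKV.
by rewrite mxE big_ord1 [X in X *: _]mulrC -scalerA bw linearZ.
Qed.

Lemma limg_induced :
  limg induced = (\sum_(a : rep_index Rx) dact U (val a) @: <[w]>)%VS.
Proof.
apply/eqP; rewrite eqEsubv; apply/andP; split.
  apply/subvP => _ /memv_imgP [f _ ->]; rewrite inducedE.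
  apply: memv_suml => a _; apply: (subvP (sumv_sup a _ (subvv _))) => //.
  by rewrite limg_line memvZ // memv_line.
apply/subv_sumP => a _; rewrite limg_line -memvE.
pose f : dsimple Rx rho := [ffun a' => (a' == a)%:R%:M].
suff -> : dact U (val a) w = induced f by rewrite memv_img ?memvf.
rewrite inducedE (bigD1 a) //= big1 ?addr0 => [|a' /negbTE a'a].
  by rewrite ffunE eqxx mxE scale1r.
by rewrite ffunE a'a mxE mul0rn scale0r.
Qed.

Lemma covers_dsimple :
  covers (\sum_(a : rep_index Rx) dact U (val a) @: <[w]>)%VS
    #|(x ^: [set: gT])%g| (dsimple Rx rho).
Proof.
exists induced; split; [exact: induced_morphism | exact: limg_induced |].
by rewrite dim_dsimple muln1.
Qed.

End Induced.

Section Degrees.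
Variable rho : mx_representation C 'C[x]%g 1.

Lemma dsimple_gr0 y :
  y \notin (x ^: [set: gT])%g -> dgr (dsimple Rx rho) y = 0%VS.
Proof.
move=> yx; apply/eqP; rewrite -subv0; apply/subvP => f /mem_simple_grP fy.
rewrite memv0; apply/eqP/ffunP => a; rewrite fy ?ffunE //.
by apply: contraNneq yx => <-; apply/mem_classT; exists (val a).
Qed.

Lemma dsimple_gr1 y : y \in (x ^: [set: gT])%g ->
  exists2 u, u != 0 & dgr (dsimple Rx rho) y = <[u]>%VS.
Proof.
case/mem_classT => g ->; pose a := coset_rep Rx g.
pose u : dsimple Rx rho := [ffun a' => (a' == a)%:R%:M].
exists u.
  apply/eqP => /ffunP/(_ a)/matrixP/(_ 0 0)/eqP.
  by rewrite !ffunE !mxE eqxx oner_eq0.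
have degE (b : rep_index Rx) :
    ((val b * x * (val b)^-1)%g == (g * x * g^-1)%g) = (b == a).
  rewrite -mem_cent1_conj; apply/idP/eqP => [|->]; last exact: coset_rep_mem.
  by move/coset_rep_uniq <-.
apply/vspaceP => f; apply/mem_simple_grP/vlineP => [fy|[c ->] b]; last first.
  by rewrite degE => /negbTE ba; rewrite !ffunE ba raddf0 scaler0.
exists (f a 0 0); apply/ffunP => b; rewrite !ffunE.
have [->|ba] := eqVneq b a; last by rewrite raddf0 scaler0 fy ?degE.
by rewrite scale_scalar_mx mulr1 -mx11_scalar.
Qed.

End Degrees.

End InducedMorphisms.

(** * Additive characters of a finite field and Fourier inversion *)

Lemma galTrace_neq0 (F0 : fieldType) (L : splittingFieldType F0) (K E : {subfield L}) :
  exists2 a, a \in E & galTrace K E a != 0.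
Proof.
(* An identically zero trace would be a linear relation, with all coefficients 1, between distinct
   automorphisms, against Dedekind's independence. *)
have [a aE tra] := @gal_independent_contra _ L E
  (fun y => y \in 'Gal(E / K)%g) (fun=> 1) 1%g (group1 _) (oner_neq0 _).
exists a => //; apply: contraNneq tra => tra; apply/eqP; rewrite -[RHS]tra.
by apply: eq_bigr => y _; rewrite mul1r.
Qed.

Section AdditiveCharacter.
Variable R : realType.

(** With [y = pi k / m] strictly between 0 and [pi], the real part is
    [cos (2 y) = 1 - 2 (sin y)^2 < 1]. *)
Lemma zetaX_neq1 m k : (0 < k < m)%N -> zeta R m ^+ k != 1.
Proof.
case/andP=> k0 km; have m0 := ltn_trans k0 km.
apply/negP => /eqP; rewrite zetaX => -[c1 _]; move: c1.
set y : R := pi * k%:R / m%:R.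
have -> : pi *+ 2 / m%:R *+ k = y *+ 2 :> R.
  by rewrite /y -[RHS]mulr_natr -[LHS]mulr_natr -[pi *+ 2]mulr_natr; ring.
rewrite cos_mulr2n cos2sin2 => sy.
have: 0 < sin y.
  apply: sin_gt0_pi; rewrite /y !mulr_gt0 ?invr_gt0 ?pi_gt0 ?ltr0n //=.
  by rewrite ltr_pdivrMr ?ltr0n // ltr_pM2l ?pi_gt0 // ltr_nat.
by move=> s0; have := mulr_gt0 s0 s0; rewrite -expr2; move: sy; lra.
Qed.

Variables (F : finFieldType) (p : nat) (hp : p \in [pchar F]).

Lemma trFp_neq0 : exists c, trFp hp c != 0.
Proof.
have [c _ trc] := @galTrace_neq0 _ (pPrimeCharType hp) 1%AS {:pPrimeCharType hp}%AS.
by exists c; apply: contraNneq trc => trc0; rewrite -trFpE trc0 scale0r.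
Qed.

Definition addchar (c : F) : R[i] := zeta R p ^+ trFp hp c.

Lemma addchar0 : addchar 0 = 1.
Proof. by rewrite /addchar trFp0. Qed.

Lemma addcharD c d : addchar (c + d) = addchar c * addchar d.
Proof. exact: zeta_trD. Qed.

Lemma addchar_neq1 : exists c, addchar c != 1.
Proof.
have [c trc] := trFp_neq0; exists c; apply: zetaX_neq1.
rewrite lt0n trc /=.
have := ltn_ord (trFp hp c); rewrite [X in (_ < X)%N -> _]Fp_cast //.
exact: pcharf_prime hp.
Qed.

(** For nonzero [c], translating [v] by [d / c] multiplies the sum by [addchar d], and some [d] has
    [addchar d != 1]. *)
Lemma sum_addchar c : \sum_v addchar (v * c) = if c == 0 then #|F|%:R else 0.
Proof.
have [->|c0] := eqVneq c 0.
  under eq_bigr => v _ do rewrite mulr0 addchar0.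
  by rewrite sumr_const.
have [d d1] := addchar_neq1; set s := \sum_v _.
have : addchar d * s = s.
  rewrite {2}/s (reindex_inj (addIr (d / c))) mulr_sumr /=.
  by apply: eq_bigr => v _; rewrite mulrDl divfK // addrC addcharD.
move/eqP; rewrite -subr_eq0 -[X in _ - X]mul1r -mulrBl mulf_eq0 subr_eq0.
by rewrite (negbTE d1) => /eqP.
Qed.

(** Fourier inversion on the additive group of [F]: after exchanging the sums, orthogonality leaves
    only the term [d = c]. *)
Lemma addchar_inversion (V : lmodType R[i]) (m : F -> V) c :
  \sum_v addchar (v * c) *: \sum_d addchar (- (v * d)) *: m d =
  #|F|%:R *: m c.
Proof.
under eq_bigr => v _ do rewrite scaler_sumr.
rewrite exchange_big (bigD1 c) //= [X in _ + X]big1 ?addr0 => [|d dc].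
  under eq_bigr => v _ do rewrite scalerA -addcharD subrr addchar0.
  by rewrite sumr_const scale1r -scaler_nat.
under eq_bigr => v _ do rewrite scalerA -addcharD -mulrBr.
by rewrite -scaler_suml sum_addchar subr_eq0 eq_sym (negbTE dc) scale0r.
Qed.

End AdditiveCharacter.

(** * Upper triangular elements in the class of a regular diagonal matrix *)

Section TriangularElements.
Variable F : finFieldType.
Implicit Types (u : {unit F}) (A : SL2 F).

Lemma sl_sign_central s A : commute (sl_sign F s) A.
Proof.
apply: slmx_inj; rewrite [LHS]slmxM [RHS]slmxM [slmx A]mat2_eta /= !mul_mat2.
by congr mat2; ring.
Qed.

Lemma sl_unipD c d : (sl_unip c * sl_unip d)%g = sl_unip (c + d) :> SL2 F.
Proof. by apply: slmx_inj; rewrite slmxM /= mul_mat2; congr mat2; ring. Qed.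

Lemma sl_unipN c : (sl_unip c)^-1%g = sl_unip (- c) :> SL2 F.
Proof.
apply/eqP; rewrite eq_invg_mul sl_unipD subrr; apply/eqP/slmx_inj.
by rewrite slmx1.
Qed.

Lemma conj_diagE u c :
  slmx (sl_unip c * sl_diag u * (sl_unip c)^-1)%g =
  mat2 (val u) (c * ((val u)^-1 - val u)) 0 (val u)^-1.
Proof. by rewrite sl_unipN !slmxM /= !mul_mat2; congr mat2; ring. Qed.

Lemma sl_diagXE u k : (sl_diag u ^+ k)%g = sl_diag (u ^+ k)%g.
Proof. by apply: slmx_inj; rewrite sl_diagX /= FinRing.val_unitX. Qed.

Lemma sl_diagV_class u : sl_diag u^-1 \in (sl_diag u ^: [set: SL2 F])%g.
Proof.
(* Conjugation by the Weyl element swaps the two diagonal entries. *)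
have detw : \det (mat2 0 1 (-1) 0 : 'M[F]_2) == 1.
  by rewrite det_mat2; apply/eqP; ring.
apply/mem_classT; exists (SL2Elt detw); apply: (mulIg (SL2Elt detw)).
rewrite mulgKV; apply: slmx_inj; rewrite !slmxM /= !mul_mat2 /= ?FinRing.val_unitV ?invrK.
by congr mat2; ring.
Qed.

(** The boolean chooses which eigenvalue stands in the upper left corner; it will label the two
    unipotent orbits. *)
Definition torus_elt u (o : bool) : SL2 F := sl_diag (if o then u^-1 else u)%g.

Lemma torus_elt_class u o : torus_elt u o \in (sl_diag u ^: [set: SL2 F])%g.
Proof. by case: o; [exact: sl_diagV_class | exact: class_refl]. Qed.

Lemma class_mxtrace u A :
  A \in (sl_diag u ^: [set: SL2 F])%g -> \tr (slmx A) = val u + (val u)^-1.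
Proof.
case/mem_classT => g ->; rewrite slmxM mxtrace_mulC -slmxM mulKg.
by rewrite /mxtrace !big_ord_recl big_ord0 !mxE /= addr0.
Qed.

Lemma mxtrace_sl A : \tr (slmx A) = slmx A 0 0 + slmx A 1 1.
Proof.
rewrite /mxtrace !big_ord_recl big_ord0 addr0; congr (_ + slmx A _ _).
  exact: val_inj.
exact: val_inj.
Qed.

Lemma det_sl A : slmx A 0 0 * slmx A 1 1 - slmx A 0 1 * slmx A 1 0 = 1.
Proof. by rewrite -det_mat2 -mat2_eta (eqP (slmxP A)). Qed.

(** Trace and determinant make the upper left entry a root of the characteristic polynomial, hence
    [u] or its inverse. Conjugating a diagonal matrix by [sl_unip c] creates the upper right entry
    [c] times the difference of the eigenvalues, which is nonzero, so [c] can be solved for. *)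
Lemma triangular_conj u A : val u != (val u)^-1 -> slmx A 1 0 = 0 ->
  \tr (slmx A) = val u + (val u)^-1 ->
  exists o c, A = (sl_unip c * torus_elt u o * (sl_unip c)^-1)%g.
Proof.
move=> uV A10; rewrite mxtrace_sl => trA.
have := det_sl A; rewrite A10 mulr0 subr0 => detA.
have u0 : val u != 0 by rewrite -unitfE (valP u).
set a := slmx A 0 0 in trA detA *; set d := slmx A 1 1 in trA detA *.
have dE : d = val u + (val u)^-1 - a by rewrite -trA; ring.
have : (a - val u) * (a - (val u)^-1) = 0.
  have -> : (a - val u) * (a - (val u)^-1) = a * a - (val u + (val u)^-1) * a + 1.
    by field.
  by rewrite -trA -detA; ring.
have uV0 : (val u)^-1 - val u != 0 by rewrite subr_eq0 eq_sym.
move/eqP; rewrite mulf_eq0 !subr_eq0 => /orP [] /eqP aE.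
  exists false, (slmx A 0 1 / ((val u)^-1 - val u)); apply: slmx_inj.
  rewrite conj_diagE divfK // [LHS]mat2_eta -/a -/d A10 dE aE.
  by congr mat2; ring.
exists true, (slmx A 0 1 / (val u - (val u)^-1)); apply: slmx_inj.
rewrite conj_diagE /= ?FinRing.val_unitV ?invrK divfK ?subr_eq0 //.
rewrite [LHS]mat2_eta -/a -/d A10 dE aE.
by congr mat2; exact: addrK.
Qed.

Lemma triangular_class u A : val u != (val u)^-1 -> slmx A 1 0 = 0 ->
  \tr (slmx A) = val u + (val u)^-1 -> A \in (sl_diag u ^: [set: SL2 F])%g.
Proof.
move=> uV A10 trA; have [o [c ->]] := triangular_conj uV A10 trA.
have /mem_classT [g ->] := torus_elt_class u o.
by apply/mem_classT; exists (sl_unip c * g)%g; rewrite invMg !mulgA.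
Qed.

(** The upper left entry determines [o], and then the upper right one determines [c]: the two orbits
    are disjoint and free. *)
Lemma conj_torus_inj u o c o' c' : val u != (val u)^-1 ->
  (sl_unip c * torus_elt u o * (sl_unip c)^-1)%g =
  (sl_unip c' * torus_elt u o' * (sl_unip c')^-1)%g -> o = o' /\ c = c'.
Proof.
move=> uV /(congr1 (@slmx F)); rewrite !conj_diagE => /mat2_inj [uu cc _ _].
have oo : o = o'.
  case: o o' uu {cc} => [] [] //= /eqP.
    by rewrite ?FinRing.val_unitV ?[_ == val u]eq_sym (negbTE uV).
  by rewrite ?FinRing.val_unitV ?[_ == val u]eq_sym (negbTE uV).
split=> //; move: cc; rewrite oo; apply: mulIf.
by rewrite subr_eq0; case: o' {uu oo}; rewrite //= ?FinRing.val_unitV ?invrK // eq_sym.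
Qed.

End TriangularElements.

(** * Factorizations of [x] through two split semisimple classes *)

Section TorusProduct.
Variables (F : finFieldType) (u1 u2 : {unit F}) (mu : bool) (b : F).
Hypotheses (u1V : val u1 != (val u1)^-1) (u2V : val u2 != (val u2)^-1) (b0 : b != 0).
Hypothesis tr12 : val u1 + (val u1)^-1 = (-1) ^+ mu * (val u2 + (val u2)^-1).

Let x : SL2 F := (sl_sign F mu * sl_unip b)%g.
Let cl1 := (sl_diag u1 ^: [set: SL2 F])%g.
Let cl2 := (sl_diag u2 ^: [set: SL2 F])%g.

Definition left_factor o c := (sl_unip c * torus_elt u1 o * (sl_unip c)^-1)%g.
Definition right_factor o c := ((left_factor o c)^-1 * x)%g.

Lemma sl_unip_comm c : (sl_unip c * x * (sl_unip c)^-1)%g = x.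
Proof.
by rewrite /x mulgA -sl_sign_central -mulgA sl_unipN -mulgA !sl_unipD addrC subrK.
Qed.

Lemma left_factorE o c :
  left_factor o c = (sl_unip c * left_factor o 0 * (sl_unip c)^-1)%g.
Proof. by rewrite /left_factor !mulgA !sl_unipD addr0 -!mulgA -invMg sl_unipD addr0. Qed.

Lemma right_factorE o c :
  right_factor o c = (sl_unip c * right_factor o 0 * (sl_unip c)^-1)%g.
Proof.
by rewrite /right_factor -{1}(sl_unip_comm c) [in LHS]left_factorE !invMg invgK !mulgA mulgKV.
Qed.

(** Entries of [B = A^-1 x], by Cramer's rule: each is multiplied by [det A = 1] and rewritten
    through the entries of [A B = x]. *)
Lemma factor_eqs (A B : SL2 F) : (A * B)%g = x ->
  [/\ slmx B 0 0 = slmx A 1 1 * (-1) ^+ mu,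
      slmx B 1 0 = - (slmx A 1 0 * (-1) ^+ mu) &
      slmx B 1 1 = (-1) ^+ mu * (slmx A 0 0 - slmx A 1 0 * b)].
Proof.
have detA := det_sl A; move=> /(congr1 (@slmx F)); rewrite /x slmxM sl_signM_unip.
rewrite [slmx A]mat2_eta [slmx B]mat2_eta mul_mat2 => /mat2_inj [e1 e2 e3 e4].
rewrite !mxE /=.
move: (slmx A 0 0) (slmx A 0 1) (slmx A 1 0) (slmx A 1 1) (slmx B 0 0) (slmx B 0 1)
  (slmx B 1 0) (slmx B 1 1) detA e1 e2 e3 e4 => a a' c d r r' s t detA e1 e2 e3 e4.
split.
- transitivity ((a * d - a' * c) * r); first by rewrite detA mul1r.
  by transitivity (d * (a * r + a' * s) - a' * (c * r + d * s)); [|rewrite e1 e3]; ring.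
- transitivity ((a * d - a' * c) * s); first by rewrite detA mul1r.
  by transitivity (a * (c * r + d * s) - c * (a * r + a' * s)); [|rewrite e1 e3]; ring.
transitivity ((a * d - a' * c) * t); first by rewrite detA mul1r.
by transitivity (a * (c * r' + d * t) - c * (a * r' + a' * t)); [|rewrite e2 e4]; ring.
Qed.

Lemma left_factor_class o c : left_factor o c \in cl1.
Proof.
have /mem_classT [g Dg] := torus_elt_class u1 o.
by apply/mem_classT; exists (sl_unip c * g)%g; rewrite /left_factor Dg invMg !mulgA.
Qed.

Lemma mul_factors o c : (left_factor o c * right_factor o c)%g = x.
Proof. exact: mulKVg. Qed.

(** The right factor is triangular because the left one is, and its trace is [mu t1 = t2];
    regularity of [u2] then fixes its class. *)
Lemma right_factor_class o c : right_factor o c \in cl2.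
Proof.
have [r00 r10 r11] := factor_eqs (mul_factors o c).
have trl := class_mxtrace (left_factor_class o c); rewrite mxtrace_sl in trl.
have l10 : slmx (left_factor o c) 1 0 = 0 by rewrite conj_diagE mxE.
apply: triangular_class => //; first by rewrite r10 l10 mul0r oppr0.
rewrite mxtrace_sl r00 r11 l10 mul0r subr0 mulrC -mulrDr [slmx _ 1 1 + _]addrC.
by rewrite trl tr12 mulrA -expr2 sqrr_sign mul1r.
Qed.

Lemma factors_exhaust (A B : SL2 F) : A \in cl1 -> B \in cl2 -> (A * B)%g = x ->
  exists o c, A = left_factor o c /\ B = right_factor o c.
Proof.
move=> /class_mxtrace trA /class_mxtrace trB AB.
have [r00 r10 r11] := factor_eqs AB.
have A10 : slmx A 1 0 = 0.
  have : slmx A 1 0 * b = \tr (slmx A) - (-1) ^+ mu * \tr (slmx B).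
    rewrite !mxtrace_sl r00 r11 [slmx A 1 1 * _]mulrC -mulrDr mulrA -expr2 sqrr_sign.
    by ring.
  by rewrite trA trB -tr12 subrr => /eqP; rewrite mulf_eq0 (negbTE b0) orbF => /eqP.
have [o [c Ac]] := triangular_conj u1V A10 trA.
by exists o, c; rewrite /right_factor /left_factor -Ac -AB mulKg.
Qed.

Lemma left_factor_inj o c o' c' :
  left_factor o c = left_factor o' c' -> o = o' /\ c = c'.
Proof. exact: conj_torus_inj. Qed.

Section Spaces.
Variables (C : fieldType) (X1 X2 : dobj C (SL2 F)).
Hypotheses (X1_0 : forall y, y \notin cl1 -> dgr X1 y = 0%VS)
           (X2_0 : forall y, y \notin cl2 -> dgr X2 y = 0%VS).
Hypotheses (X1_1 : forall y, y \in cl1 -> exists2 u, u != 0 & dgr X1 y = <[u]>%VS)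
           (X2_1 : forall y, y \in cl2 -> exists2 u, u != 0 & dgr X2 y = <[u]>%VS).

(** Each of the [2 q] pairs [(left_factor o c, right_factor o c)] contributes a tensor product of
    two lines. This bound closes the final comparison of dimensions. *)
Lemma dim_product_ge : (2 * #|F| <= \dim (dgr (dtens X1 X2) x))%N.
Proof.
rewrite /= dim_tens_gr.
pose f (oc : bool * F) := (left_factor oc.1 oc.2, right_factor oc.1 oc.2).
have f_inj : injective f.
  by move=> [o c] [o' c'] /(congr1 fst)/left_factor_inj [/= -> ->].
have -> : (2 * #|F|)%N = #|[set f oc | oc in [set: bool * F]]|.
  by rewrite card_imset // cardsT card_prod card_bool.
rewrite -sum1_card big_mkcond [X in (_ <= X)%N]big_mkcond; apply: leq_sum => yz _.
case: imsetP => // -[[o c] _ ->] /=; rewrite mul_factors eqxx.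
have [u u0 ->] := X1_1 (left_factor_class o c).
have [v v0 ->] := X2_1 (right_factor_class o c).
by rewrite !dim_vline u0 v0.
Qed.

(** [m o] spans the line over the base pair with [c = 0]. By [factors_exhaust] its unipotent
    translates reach the lines over all pairs. Spanning is stated against an arbitrary [W] so that
    it applies directly to the span of the Fourier vectors. *)
Lemma product_orbits : exists m : bool -> dtens X1 X2,
  (forall o, m o \in dgr (dtens X1 X2) x) /\
  (forall W : {vspace dtens X1 X2},
    (forall o c, dact (dtens X1 X2) (sl_unip c) (m o) \in W) ->
    (dgr (dtens X1 X2) x <= W)%VS).
Proof.
have [n1 [n2 n12]] : exists n1 n2, forall o,
  dgr X1 (left_factor o 0) = <[n1 o]>%VS /\ dgr X2 (right_factor o 0) = <[n2 o]>%VS.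
  have [uf _ uf1] := X1_1 (left_factor_class false 0).
  have [ut _ ut1] := X1_1 (left_factor_class true 0).
  have [vf _ vf1] := X2_1 (right_factor_class false 0).
  have [vt _ vt1] := X2_1 (right_factor_class true 0).
  by exists (fun o => if o then ut else uf), (fun o => if o then vt else vf) => -[].
pose m o := tens (n1 o) (n2 o).
exists m; split=> [o|W Wm].
  rewrite -(mul_factors o 0); have [d1 d2] := n12 o.
  by apply: mem_tens_gr; rewrite ?d1 ?d2 memv_line.
apply/subv_sumP => -[y z] /= /eqP yz; apply: tensv_subv => u v.
have [y1|/X1_0 ->] := boolP (y \in cl1); last first.
  (* Writing the zero vector as [0 *: 0] lets [tensZZ] annihilate the tensor. *)
  by rewrite memv0 => /eqP -> _; rewrite -[0](scale0r 0) -[v]scale1r tensZZ mul0r scale0r mem0v.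
have [z2|/X2_0 ->] := boolP (z \in cl2); last first.
  by rewrite memv0 => _ /eqP ->; rewrite -[0](scale0r 0) -[u]scale1r tensZZ mulr0 scale0r mem0v.
have [o [c [-> ->]]] := factors_exhaust y1 z2 yz; have [d1 d2] := n12 o.
have -> : dgr X1 (left_factor o c) = <[dact X1 (sl_unip c) (n1 o)]>%VS.
  by rewrite left_factorE -dactJ d1 limg_line.
have -> : dgr X2 (right_factor o c) = <[dact X2 (sl_unip c) (n2 o)]>%VS.
  by rewrite right_factorE -dactJ d2 limg_line.
move=> /vlineP [k ->] /vlineP [l ->].
by rewrite tensZZ memvZ //; have := Wm o c; rewrite /= tens_actE.
Qed.

End Spaces.

End TorusProduct.

(** * Elements acting by scalars on tensor products *)

Section Scalars.
Import VectorInternalTheory.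
Lemma f2mx_scalar (C : fieldType) (W : vectType C) (c : C) :
  f2mx (c *: \1%VF : 'End(W)) = c%:M.
Proof.
apply/row_matrixP => i.
rewrite !rowE -[delta_mx _ _]r2vK -v2r_lfun.
set w := r2v _.
have -> : (c *: \1%VF : 'End(W)) w = c *: w by rewrite scale_lfunE id_lfunE.
by rewrite linearZ mul_mx_scalar.
Qed.

Lemma dact_dtens_scalar (C : fieldType) (gT : finGroupType) (U V : dobj C gT) g c d :
  (forall u, dact U g u = c *: u) -> (forall v, dact V g v = d *: v) ->
  forall t, dact (dtens U V) g t = (c * d) *: t.
Proof.
move=> Ug Vg t.
have -> : dact (dtens U V) g t = (f2mx (dact U g))^T *m t *m
  f2mx (dact V g) by rewrite lfunE.
have -> : dact U g = c *: \1%VF by apply/lfunP => u; rewrite scale_lfunE id_lfunE Ug.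
have -> : dact V g = d *: \1%VF by apply/lfunP => v; rewrite scale_lfunE id_lfunE Vg.
by rewrite !f2mx_scalar tr_scalar_mx mul_scalar_mx mul_mx_scalar scalerA mulrC.
Qed.

End Scalars.

(** * The action of the centre and the eigenvectors of the unipotent subgroup *)

Section Eigenvectors.
Variables (R : realType) (F : finFieldType) (p : nat) (hp : p \in [pchar F]).

(** In dimension one [rho (-1)] is a scalar of square 1, and [rep_even] tells which sign it is. *)
Lemma rep_sl_sign (y : SL2 F) (rho : mx_representation R[i] 'C[y]%g 1) s :
  rho (sl_sign F s) = (((-1) ^+ s) ^+ (~~ rep_even rho))%:M.
Proof.
have sC z : sl_sign F z \in 'C[y]%g by exact/cent1P/sl_sign_central.
case: s; last first.
  rewrite expr0 expr1n (_ : sl_sign F false = 1%g) ?repr_mx1 //.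
  by apply: slmx_inj; rewrite slmx1 /= expr0.
rewrite expr1 /rep_even; case: eqP => [-> //|rho1 /=]; rewrite expr1.
have sK : (sl_sign F true * sl_sign F true)%g = 1%g.
  by apply: slmx_inj; rewrite slmxM slmx1 /= mul_mat2 expr1; congr mat2; ring.
have: rho (sl_sign F true) *m rho (sl_sign F true) = 1%:M.
  by rewrite -repr_mxM ?sC // sK repr_mx1.
move: (rho _) rho1 => M; rewrite [M]mx11_scalar; move: (M 0 0) => c c1.
rewrite -scalar_mxM => /matrixP/(_ 0 0); rewrite !mxE !eqxx !mulr1n => /eqP.
by rewrite -expr2 sqrf_eq1 => /orP [] /eqP cE; rewrite ?cE // in c1 *.
Qed.

(** Up to the factor [#|F|], the projection of [m] onto the eigenspace where [sl_unip c] acts by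
    [addchar (v * c)]. *)
Definition fourier_vec (U : dobj R[i] (SL2 F)) (m : U) (v : F) : U :=
  \sum_c addchar R hp (- (v * c)) *: dact U (sl_unip c) m.

Lemma dact_fourier_vec (U : dobj R[i] (SL2 F)) (m : U) v d :
  dact U (sl_unip d) (fourier_vec m v) = addchar R hp (v * d) *: fourier_vec m v.
Proof.
rewrite linear_sum scaler_sumr (reindex_inj (addIr (- d))) /=.
apply: eq_bigr => c _; rewrite linearZ /= -comp_lfunE -dactM sl_unipD scalerA -addcharD.
by rewrite [d + _]addrC subrK; congr (addchar _ _ _ *: _); ring.
Qed.

(** By Fourier inversion, a translate of [m] is a combination of the Fourier vectors; [#|F|] is
    invertible in characteristic zero. *)
Lemma fourier_vec_span (U : dobj R[i] (SL2 F)) (m : U) c (W : {vspace U}) :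
  (forall v, fourier_vec m v \in W) -> dact U (sl_unip c) m \in W.
Proof.
move=> Wm; have F0 : #|F|%:R != 0 :> R[i].
  by rewrite pnatr_eq0 -lt0n; apply/card_gt0P; exists 0.
rewrite -[dact _ _ _]scale1r -(mulVf F0) -scalerA.
rewrite -(addchar_inversion hp (fun c => dact U (sl_unip c) m)).
by apply/memvZ/memv_suml => v _; apply: memvZ; exact: Wm.
Qed.

End Eigenvectors.

(** * Decomposition of the product over the class of [mu b_eps] *)

Lemma sl_diag_regular (F : finFieldType) (e : {unit F}) h k :
  generator [set: {unit F}] e -> #|F| = (4 * h + 1)%N ->
  (1 <= k <= 2 * h - 1)%N -> val (e ^+ k)%g != (val (e ^+ k)%g)^-1.
Proof.
move=> ge Fh hk; apply/negP => /eqP ek.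
have : (e ^+ k * e ^+ k == 1)%g.
  apply/eqP/val_inj; move: ek; move: (e ^+ k)%g => u uV.
  by rewrite FinRing.val_unitM {2}uV mulrV // (valP u).
(* The order [4h] of [e] would divide [2k], while [0 < 2k < 4h]. *)
rewrite -expgD -order_dvdn (order_gen ge) Fh => /dvdn_leq; lia.
Qed.

Theorem mainTheorem4
  (R : realType) (p n h : nat) (F K : finFieldType)
  (charF : p \in [pchar F]) (p_odd : odd p)
  (cardF : #|F| = (p ^ n)%N) (F_ge5 : (5 <= #|F|)%N)
  (cardF4h : #|F| = (4 * h + 1)%N)
  (cardK : #|K| = (#|F| ^ 2)%N) (iota : {rmorphism F -> K})
  (ce : {unit K}) (gen_ce : generator [set: {unit K}] ce)
  (e : {unit F}) (def_e : iota (val e) = val ce ^+ (4 * h + 2))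
  (reps : forall x : SL2 F, coset_reps x)
  (mu eps : bool) (k1 k2 : nat)
  (hk1 : (1 <= k1 <= 2 * h - 1)%N) (hk2 : (1 <= k2 <= 2 * h - 1)%N)
  (u1 u2 : 'Z_(#|F|.-1))
  (ht : val e ^+ k1 + val e ^- k1 = (-1) ^+ mu * (val e ^+ k2 + val e ^- k2)) :
  let gen_e := e_generator cardF4h cardK gen_ce def_e in
  let X1 := Aobj R gen_e cardF4h hk1 u1 (reps (sl_diag e ^+ k1)%g) in
  let X2 := Aobj R gen_e cardF4h hk2 u2 (reps (sl_diag e ^+ k2)%g) in
  let nu := rep_even (ustar_repr R gen_e cardF4h u1 hk1)
            != rep_even (ustar_repr R gen_e cardF4h u2 hk2) in
  let B v := Bobj R charF nu v (reps (sl_bb e mu eps)) in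
  disom (dsupp (dtens X1 X2) (sl_bb e mu eps))
        (\big[@dsum R[i] (SL2 F) / @dzero R[i] (SL2 F)]_(v : F)
           dsum (B v) (B v)).
Proof.
move=> gen_e X1 X2 nu B.
have v1 : val (e ^+ k1)%g = val e ^+ k1 by rewrite FinRing.val_unitX.
have v2 : val (e ^+ k2)%g = val e ^+ k2 by rewrite FinRing.val_unitX.
have u1V := sl_diag_regular gen_e cardF4h hk1.
have u2V := sl_diag_regular gen_e cardF4h hk2.
have b0 : val e ^+ eps != 0 by rewrite expf_neq0 // -unitfE (valP e).
have tr12 : val (e ^+ k1)%g + (val (e ^+ k1)%g)^-1 =
    (-1) ^+ mu * (val (e ^+ k2)%g + (val (e ^+ k2)%g)^-1) by rewrite v1 v2.
set x := sl_bb e mu eps; set U := dtens X1 X2.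
have X1_0 y : y \notin (sl_diag (e ^+ k1)%g ^: [set: SL2 F])%g -> dgr X1 y = 0%VS.
  by rewrite -sl_diagXE; exact: dsimple_gr0.
have X2_0 y : y \notin (sl_diag (e ^+ k2)%g ^: [set: SL2 F])%g -> dgr X2 y = 0%VS.
  by rewrite -sl_diagXE; exact: dsimple_gr0.
have X1_1 y : y \in (sl_diag (e ^+ k1)%g ^: [set: SL2 F])%g ->
    exists2 u, u != 0 & dgr X1 y = <[u]>%VS.
  by rewrite -sl_diagXE; exact: dsimple_gr1.
have X2_1 y : y \in (sl_diag (e ^+ k2)%g ^: [set: SL2 F])%g ->
    exists2 u, u != 0 & dgr X2 y = <[u]>%VS.
  by rewrite -sl_diagXE; exact: dsimple_gr1.
have dimU := dim_product_ge (val e ^+ eps) u1V u2V tr12 X1_1 X2_1.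
have [m [mx mW]] := product_orbits u1V u2V b0 tr12 X1_0 X2_0 X1_1 X2_1.
rewrite -/x -/U in dimU mx mW.
pose w o v := fourier_vec charF (m o) v.
have wx o v : w o v \in dgr U x.
  apply: memv_suml => c _; apply: memvZ.
  have <- : (sl_unip c * x * (sl_unip c)^-1)%g = x by exact: sl_unip_comm.
  exact: mem_dact (mx o).
(* The centre acts on [X1] and [X2] through their parities. With [true] standing for [-], the
   product of the two signs has exponent [nu], the boolean difference of the parities. *)
have U_sign s t : dact U (sl_sign F s) t = ((-1) ^+ s) ^+ nu *: t.
  rewrite (dact_dtens_scalar (g := sl_sign F s)
    (fun t => dact_dsimple_central t (sl_sign_central s) (rep_sl_sign _ s))
    (fun t => dact_dsimple_central t (sl_sign_central s) (rep_sl_sign _ s))).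
  congr (_ *: _); rewrite /nu; do 2!case: (rep_even _); rewrite /= ?expr0 ?mulr1 ?mul1r //.
  by rewrite expr1 -expr2 sqrr_sign.
have wB o v : {in 'C[x]%g, forall y,
    dact U y (w o v) = bstar_repr R charF e mu eps nu v y 0 0 *: w o v}.
  move=> _ /cent_bb [s [d ->]]; rewrite dactM comp_lfunE.
  have -> : dact U (sl_unip d) (w o v) = addchar R charF (v * d) *: w o v.
    exact: dact_fourier_vec.
  by rewrite U_sign scalerA; congr (_ *: _); rewrite /= bstarE // mxE eqxx mulr1n.
(* One morphism from [B v] for each orbit [o]: this is where the multiplicity two comes from. *)
have coversB o v := covers_dsimple (reps x) (rho := bstar_repr R charF e mu eps nu v)
  (wx o v) (wB o v).
have coversBB v := covers_dsum (coversB false v) (coversB true v).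
have w_span : dgr U x = (\sum_v (<[w false v]> + <[w true v]>))%VS.
  apply/eqP; rewrite eqEsubv; apply/andP; split.
    apply: mW => o c; apply: (fourier_vec_span (hp := charF)) => v.
    apply: (subvP (sumv_sup v _ (subvv _))) => //.
    by case: o; [apply: (subvP (addvSr _ _)) | apply: (subvP (addvSl _ _))]; exact: memv_line.
  by apply/subv_sumP => v _; rewrite subv_add -!memvE !wx.
have cov := covers_bigdsum (index_enum F) coversBB.
(* The vectors [w o v] span degree [x], and the coset representatives carry this degree onto every
   degree of the class. *)
have suppE : (\sum_v (\sum_(a : rep_index (reps x)) dact U (val a) @: <[w false v]> +
    \sum_(a : rep_index (reps x)) dact U (val a) @: <[w true v]>))%VS = supp_space U x.
  rewrite -(sum_dact_rep (reps x)) w_span.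
  under [RHS]eq_bigr => a _ do rewrite limg_sum.
  rewrite [RHS]exchange_big; apply: eq_bigr => v _.
  by rewrite -big_split; apply: eq_bigr => a _; rewrite limgD.
rewrite suppE in cov; apply: disom_dsupp cov _.
(* It remains to compare [2 q] times the size of the class with that size times the dimension of
   degree [x], which is [dimU]. *)
rewrite sum_nat_const dim_supp_space addnn -mul2n mulnA mulnC leq_mul2l.
by rewrite [X in (X <= _)%N]mulnC dimU orbT.
Qed.
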